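(* Let $k>0$, let $G\in\mathbf{RH}_\infty$ (scalar), and let $\phi:\mathbb{R}\to\mathbb{R}$ be a memoryless nonlinearity with $\phi(0)=0$ that is slope-restricted in $S[0,k]$. Let $P(z)=1+kG(z)$ have state-space description $(A_p,B_p,C_p,D_p)$ with $A_p\in\mathbb{R}^{n_p\times n_p}$. Let $n_f,n_b\ge 1$ be integers, $n=\max(n_f,n_b)$, and let $\tilde A,\tilde B$, $C_i,D_i$ ($i=-n_f,\dots,n_b$) and $M_f$ be the matrices built from $(A_p,B_p,C_p,D_p)$, $n_f$, $n_b$ as specified in the context. Suppose there exist a real vector $$m^\top=\begin{bmatrix} m_{-n_f} & \cdots & m_{-1} & 1 & m_1 & \cdots & m_{n_b}\end{bmatrix}$$ (so $m_0=1$) and a matrix $X=X^\top\in\mathbb{R}^{(n_p+n)\times(n_p+n)}$ such that $$\begin{bmatrix}\tilde A^\top X\tilde A-X & \tilde A^\top X\tilde B\\ \tilde B^\top X\tilde A & \tilde B^\top X\tilde B\end{bmatrix}-M_f^\top\,\Pi\, M_f<0,\qquad \Pi=\begin{bmatrix}0& m\\ m^\top & 0\end{bmatrix},$$ and such that at least one of the following holds: (a) $m_i\le 0$ for $i=-n_f,\dots,-1$ and $i=1,\dots,n_b$, and $\sum_{i=-n_f}^{n_b}m_i>0$; (b) $\phi$ is odd, and one can write $m_i=m_i^+-m_i^-$ for $i=-n_f,\dots,n_b$, with $m_0^+=1$, $m_0^-=0$, $m_i^+\ge 0$ and $m_i^-\ge 0$ for all $i$, and $\sum_{i=-n_f}^{n_b}m_i^++\sum_{i=-n_f}^{n_b}m_i^-<2$.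 Then the feedback interconnection $v_j=f_j+(Gw)_j$, $w_j=-\phi(v_j)+g_j$ ($j\in\mathbb{Z}_+$) is $\ell_2$-stable.
   Context: Notation. $\mathbb{Z}_+$ is the set of nonnegative integers; $\ell$ is the space of real sequences on $\mathbb{Z}_+$ and $\ell_2\subset\ell$ the square-summable ones. $\mathbf{RH}_\infty$ is the space of real rational transfer functions with all poles strictly inside the unit circle; $G$ acts on $\ell$ as the corresponding causal LTI operator (zero initial state). A state-space description $(A,B,C,D)$ of a transfer function $H$ means $H(z)=C(zI-A)^{-1}B+D$, $z$ denoting the forward shift. $\phi$ is slope-restricted in $S[0,k]$ if $0\le \frac{\phi(x_1)-\phi(x_2)}{x_1-x_2}\le k$ for all real $x_1\ne x_2$; $\phi$ is odd if $\phi(-x)=-\phi(x)$ for all $x$. The feedback interconnection is well-posed if the map $(v,w)\mapsto(g,f)$ has a causal inverse on $\ell\times\ell$; it is $\ell_2$-stable if for any $f,g\in\ell_2$ both $v,w\in\ell_2$. For symmetric matrices, $<0$ means negative definite. Matrices. $0_j$ is a zero row vector with $j$ entries, $I_j$ the $j\times j$ identity, $0$ a zero block of appropriate size. With $n=\max(n_f,n_b)$, $$\tilde A=\begin{bmatrix}A_p&B_p&0\\0&0&I_{n-1}\\0&0&0\end{bmatrix}\in\mathbb{R}^{(n_p+n)\times(n_p+n)},\qquad \tilde B=\begin{bmatrix}0\\0\\1\end{bmatrix}\in\mathbb{R}^{(n_p+n)\times 1}$$ (the last row of $\tilde A$ is zero, and the only nonzero entry of $\tilde B$ is its last entry), $$\bar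 C=\begin{bmatrix}C_p&D_p&0_{n-1}\end{bmatrix},\qquad C_{d,j}=\begin{bmatrix}0_{n_p+n-j}&1&0_{j-1}\end{bmatrix}\ (j=1,\dots,n_f).$$ For $i=-n_f,\dots,-1$: $$C_i=\bar C\tilde A^{\,n-i}+\sum_{j=1}^{-i}\big(\bar C\tilde A^{\,n-i-j-1}\tilde B\big)C_{d,j},\qquad D_i=\bar C\tilde A^{\,n-i-1}\tilde B.$$ For $i=0$: $C_0=\bar C\tilde A^{\,n}$, $D_0=\bar C\tilde A^{\,n-1}\tilde B$. For $i=1,\dots,n_b$: $C_i=\bar C\tilde A^{\,n-i}$, $D_i=0$. Finally $$M_f=\begin{bmatrix}C_{-n_f}&D_{-n_f}\\ \vdots&\vdots\\ C_{n_b}&D_{n_b}\\ 0&1\end{bmatrix}.$$ *)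

(* Defs.v *)
From HB Require Import structures.
From mathcomp Require Import all_boot all_order all_algebra.
From mathcomp Require Import complex.
From mathcomp Require Import boolp classical_sets reals topology normedtype.
From mathcomp Require Import sequences.

Set Implicit Arguments.
Unset Strict Implicit.
Unset Printing Implicit Defensive.

Import Order.TTheory GRing.Theory Num.Theory.
Import numFieldNormedType.Exports.

Local Open Scope ring_scope.

Definition in_l2 (R : realType) (x : nat -> R) : Prop :=
  cvgn (series (fun j => x j ^+ 2)).

Definition slope_restricted (R : realType) (k : R) (phi : R -> R) : Prop :=
  forall x1 x2 : R, x1 != x2 ->
    0 <= (phi x1 - phi x2) / (x1 - x2) <= k.

Definition odd_function (R : realType) (phi : R -> R) : Prop :=
  forall x : R, phi (- x) = - phi x.

(* Scalar transfer functions are elements of the field {fraction {poly R}} of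
   real rational functions; 'X is the forward shift z. *)

Definition tf_poly (R : realType) (p : {poly R}) : {fraction {poly R}} :=
  FracField.tofrac p.

Definition tf_const (R : realType) (a : R) : {fraction {poly R}} :=
  tf_poly a%:P.

Definition tf_z (R : realType) : {fraction {poly R}} := tf_poly 'X.

(* As p / q is in lowest terms, the finite poles of G are exactly the complex
   roots of q; size p <= size q says that there is no pole at infinity. *)
Definition in_RHinf (R : realType) (G : {fraction {poly R}}) : Prop :=
  exists p q : {poly R},
    [/\ G = tf_poly p / tf_poly q, q != 0, coprimep p q, (size p <= size q)%N
      & forall z : R[i], root (map_poly (real_complex R) q) z -> `|z| < 1].

(* The impulse response of a proper G, i.e. the coefficient h_j in the expansion
   G(z) = sum_(j >= 0) h_j z^(-j) at infinity, is the constant coefficient of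
   the polynomial part of z^j G(z).  It is read off here from one fraction
   representing G; by impulse_frac any other gives the same value. *)
Definition impulse (R : realType) (G : {fraction {poly R}}) (j : nat) : R :=
  (('X^j * (frac (repr G)).1) %/ (frac (repr G)).2)`_0.

Lemma impulse_frac (R : realType) (p q : {poly R}) (j : nat) :
  q != 0 -> impulse (tf_poly p / tf_poly q) j = (('X^j * p) %/ q)`_0.
Proof.
move=> q0; rewrite /impulse.
set G := tf_poly p / tf_poly q.
set a := (frac (repr G)).1; set b := (frac (repr G)).2.
have b0 : b != 0 by exact: denom_ratioP.
have Gb : G * tf_poly b = tf_poly a.
  rewrite -[G]reprK /tf_poly; unlock FracField.tofrac.
  rewrite -[LHS]FracField.pi_mul; apply/eqmodP; rewrite /= FracField.equivfE.
  rewrite /FracField.mulf /= !numden_Ratio ?mulf_neq0 ?denom_ratioP ?oner_neq0 //.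
  by rewrite !mulr1 -/a -/b mulrC.
have E : a * q = p * b.
  apply/eqP; rewrite -tofrac_eq !tofracM -/(tf_poly _) -/(tf_poly _).
  rewrite -/(tf_poly _) -/(tf_poly _) -Gb /G mulrAC divfK //.
  by rewrite /tf_poly tofrac_eq0.
rewrite -(divp_pmul2r ('X^j * a) q0 b0) -(divp_pmul2r ('X^j * p) b0 q0).
by rewrite -!mulrA E [b * q]mulrC.
Qed.

(* Causal action of G on sequences, from zero initial state. *)
Definition lti (R : realType) (G : {fraction {poly R}}) (w : nat -> R)
    (j : nat) : R :=
  \sum_(i < j.+1) impulse G (j - i) * w i.

(* H(z) = C (zI - A)^-1 B + D, as an equality of rational functions; zI - A is
   invertible over that field for every real matrix A. *)
Definition realizes (R : realType) (np : nat) (A : 'M[R]_np) (B : 'cV[R]_np)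
    (C : 'rV[R]_np) (D : R) (H : {fraction {poly R}}) : Prop :=
  H = (map_mx (@tf_const R) C
         *m invmx ((tf_z R)%:M - map_mx (@tf_const R) A)
         *m map_mx (@tf_const R) B) 0 0 + tf_const D.

Definition feedback (R : realType) (G : {fraction {poly R}}) (phi : R -> R)
    (f g v w : nat -> R) : Prop :=
  forall j : nat, v j = f j + lti G w j /\ w j = - phi (v j) + g j.

(* The existence clause keeps the definition from holding vacuously when the
   loop equations have no solution. *)
Definition l2_stable (R : realType) (G : {fraction {poly R}}) (phi : R -> R) :
    Prop :=
  forall f g : nat -> R, in_l2 f -> in_l2 g ->
    (exists v w : nat -> R, feedback G phi f g v w) /\
    (forall v w : nat -> R, feedback G phi f g v w -> in_l2 v /\ in_l2 w).

Definition negdef (R : realType) (d : nat) (S : 'M[R]_d) : Prop :=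
  forall x : 'cV[R]_d, x != 0 -> (x^T *m S *m x) 0 0 < 0.

Section Matrices.
Context {R : realType} {np : nat}.
Variables (Ap : 'M[R]_np) (Bp : 'cV[R]_np) (Cp : 'rV[R]_np) (Dp : R).
Variables nf nb : nat.

Notation n := (maxn nf nb).

(* The last n states form a delay line.  The columns of the blocks of widths 1
   and n - 1 are merged into one block of width n, so the entries Bp (and Dp in
   Cbar) sit in its column 0, and the identity of size n - 1 gives its
   superdiagonal. *)
Definition Atilde : 'M[R]_(np + n) :=
  block_mx Ap (\matrix_(i < np, j < n) (if j == 0%N :> nat then Bp i 0 else 0))
           0  (\matrix_(i < n, j < n) (j == i.+1 :> nat)%:R).

Definition Btilde : 'cV[R]_(np + n) :=
  \col_(i < np + n) (i.+1 == (np + n)%N :> nat)%:R.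

Definition Cbar : 'rV[R]_(np + n) :=
  row_mx Cp (\row_(j < n) (if j == 0%N :> nat then Dp else 0)).

Definition Cdelay (j : nat) : 'rV[R]_(np + n) :=
  \row_(l < np + n) (l == (np + n - j)%N :> nat)%:R.

Definition markov_par (e : nat) : R := (Cbar *m Atilde ^+ e *m Btilde) 0 0.

(* Rows C_i and D_i for integer i; Negz s stands for i = - (s + 1). *)
Definition Crow (i : int) : 'rV[R]_(np + n) :=
  match i with
  | Posz i => Cbar *m Atilde ^+ (n - i)
  | Negz s => Cbar *m Atilde ^+ (n + s.+1)
              + \sum_(1 <= j < s.+2) markov_par (n + s.+1 - j - 1) *: Cdelay j
  end.

Definition Drow (i : int) : R :=
  match i with
  | Posz 0 => markov_par (n - 1)
  | Posz _.+1 => 0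
  | Negz s => markov_par (n + s.+1 - 1)
  end.

(* The index -nf, ..., nb of the r-th row. *)
Definition lag (r : 'I_(nf + nb).+1) : int := r%:Z - nf%:Z.

Definition Mf : 'M[R]_((nf + nb).+1 + 1, (np + n) + 1) :=
  block_mx (\matrix_(r < (nf + nb).+1) Crow (lag r))
           (\col_(r < (nf + nb).+1) Drow (lag r))
           0 1%:M.

Definition Pi (m : 'cV[R]_(nf + nb).+1) : 'M[R]_((nf + nb).+1 + 1) :=
  block_mx 0 m m^T 0.

Definition lmi_matrix (m : 'cV[R]_(nf + nb).+1) (X : 'M[R]_(np + n)) :
    'M[R]_((np + n) + 1) :=
  block_mx (Atilde^T *m X *m Atilde - X) (Atilde^T *m X *m Btilde)
           (Btilde^T *m X *m Atilde)     (Btilde^T *m X *m Btilde)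
  - Mf^T *m Pi m *m Mf.

End Matrices.

(* Main.v *)
Require Import Defs.
From HB Require Import structures.
From mathcomp Require Import all_boot all_order all_algebra.
From mathcomp Require Import complex.
From mathcomp Require Import boolp classical_sets reals topology normedtype.
From mathcomp Require Import sequences.
From mathcomp Require Import ring lra zify.

Set Implicit Arguments.
Unset Strict Implicit.
Unset Printing Implicit Defensive.

Import Order.TTheory GRing.Theory Num.Theory.
Import numFieldNormedType.Exports.

Local Open Scope ring_scope.

(** The proof replaces the integrals of the integral-quadratic-constraint method by
    finite sums, and its frequency domain by sampling on roots of unity.

    The matrix inequality is read along the exponential trajectory of a frequency z
    with |z| = 1.  There the storage function X contributes nothing, so the
    inequality says that M(z) P(z), where M(z) is the sum of the m_i z^(-i) and
    P = 1 + k G, has real part at least some eps > 0 on the whole unit circle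
    ([lmi_frequency]).  As G is stable, its impulse
    response is absolutely summable and its truncations converge uniformly on the
    circle ([expansion_l1], [expansion_circle]); averaging over N-th roots of unity
    with N large turns the frequency inequality into a lower bound of the pairing of
    w with M P w by eps/2 times the square sum of w, for finite signals w
    ([positive_on_signals], [plant_positive]).

    On the other side, phi and x |-> k x - phi x are both nondecreasing, so the
    rearrangement inequality gives the Zames-Falb inequality: the pairing of
    phi(v) with M (k v - phi(v)) is nonnegative, already for every finite section of
    the two sequences ([zames_falb]).  Along a loop solution phi(v) = g - w and
    k v - phi(v) = P w + (k f - g), and the two inequalities together bound the
    square sum of w by that of f and g, provided that w is known to be square
    summable ([apriori]).  The proviso matters, since M is not causal and a truncated
    solution loses terms at its end.

    It is removed by a homotopy that scales G by tau from 0 to 1.  The bound is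
    uniform in tau, so square summability passes from tau to tau' by the small gain
    theorem when |tau' - tau| is below a fixed constant ([stable_at_step]).
    The same bound, applied to phi x = k x and a unit impulse, keeps
    1 + k tau h(0) positive, h being the impulse response of G.  This makes every
    time step solvable ([step_solvable]), and at tau = 1 it gives existence of
    solutions. *)

(** * Square sums, convolution and Schur's test *)

Lemma sum_ord_trunc (V : nmodType) (T n : nat) (F : nat -> V) :
  \sum_(a < T + n) (if (a < T)%N then F a else 0) = \sum_(a < T) F a.
Proof. by rewrite [RHS](big_ord_widen (T + n) F) ?leq_addr // [RHS]big_mkcond. Qed.

Lemma sum_ord_delta (V : pzSemiRingType) (T c : nat) (F : nat -> V) :
  \sum_(b < T) (c == b)%:R * F b = (c < T)%:R * F c.
Proof.
case: (ltnP c T) => h.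
  rewrite (bigD1 (Ordinal h)) //= eqxx big1 ?addr0 // => b nb.
  suff /negbTE -> : c != b by rewrite mul0r.
  by apply: contra nb => /eqP e; apply/eqP/val_inj.
rewrite mul0r big1 // => b _; suff /negbTE -> : c != b by rewrite mul0r.
by apply/eqP => e; move: (ltn_ord b); rewrite -e ltnNge h.
Qed.

Section FiniteForms.
Context {R : realFieldType}.
Implicit Types (x y u v w : nat -> R).

Definition sqn (T : nat) x : R := \sum_(a < T) x a ^+ 2.

Lemma sqn_ge0 T x : 0 <= sqn T x.
Proof. by apply: sumr_ge0 => a _; apply: sqr_ge0. Qed.

Lemma le_sqn T T' x : (T <= T')%N -> sqn T x <= sqn T' x.
Proof.
move=> le; rewrite /sqn -!(big_mkord xpredT (fun a => x a ^+ 2)).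
rewrite [leRHS](big_cat_nat (n := T)) //= lerDl; apply: sumr_ge0 => a _; exact: sqr_ge0.
Qed.

Lemma eq_sqn T x y : (forall a, (a < T)%N -> x a = y a) -> sqn T x = sqn T y.
Proof. by move=> e; apply: eq_bigr => a _; rewrite e. Qed.

Lemma le_sqn2 T x y : (forall a, (a < T)%N -> `|x a| <= `|y a|) -> sqn T x <= sqn T y.
Proof.
move=> e; apply: ler_sum => a _.
by rewrite -(real_normK (num_real (x a))) -(real_normK (num_real (y a))) lerXn2r ?nnegrE ?normr_ge0 ?e.
Qed.

Lemma sqnD T x y : sqn T (fun a => x a + y a) <= 2 * sqn T x + 2 * sqn T y.
Proof.
rewrite /sqn !mulr_sumr -big_split; apply: ler_sum => a _ /=.
by have := sqr_ge0 (x a - y a); lra.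
Qed.

Lemma sqnZ T c x : sqn T (fun a => c * x a) = c ^+ 2 * sqn T x.
Proof. by rewrite /sqn mulr_sumr; apply: eq_bigr => a _; rewrite exprMn. Qed.

(** Schur's test: a matrix whose rows and columns have absolute sums at most
    alpha is bounded by alpha on square sums; the weight K splits the bound
    unevenly between the two arguments. *)
Lemma schur_test (I J : finType) (S : I -> J -> R) (alpha K : R)
    (x : I -> R) (y : J -> R) :
  0 < K ->
  (forall i, \sum_j `|S i j| <= alpha) -> (forall j, \sum_i `|S i j| <= alpha) ->
  2 * `|\sum_i \sum_j S i j * x i * y j| <=
    alpha * (K * \sum_i x i ^+ 2 + K^-1 * \sum_j y j ^+ 2).
Proof.
move=> K0 hr hc.
have yng (a b : R) : 2 * `|a * b| <= K * a ^+ 2 + K^-1 * b ^+ 2.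
  rewrite normrM -[a ^+ 2]real_normK ?num_real // -[b ^+ 2]real_normK ?num_real //.
  have Kn : K != 0 by rewrite gt_eqF.
  rewrite -subr_ge0.
  have -> : K * `|a| ^+ 2 + K^-1 * `|b| ^+ 2 - 2 * (`|a| * `|b|) =
     K^-1 * (K * `|a| - `|b|) ^+ 2 by field.
  by rewrite mulr_ge0 ?sqr_ge0 // invr_ge0 ltW.
apply: (@le_trans _ _ (\sum_i \sum_j `|S i j| * (K * x i ^+ 2 + K^-1 * y j ^+ 2))).
  apply: (@le_trans _ _ (2 * \sum_i \sum_j `|S i j * x i * y j|)).
    rewrite ler_pM2l //; apply: (le_trans (ler_norm_sum _ _ _)).
    by apply: ler_sum => i _; apply: ler_norm_sum.
  rewrite mulr_sumr; apply: ler_sum => i _; rewrite mulr_sumr.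
  apply: ler_sum => j _; rewrite -mulrA normrM mulrCA ler_wpM2l //; exact: yng.
have -> : \sum_i \sum_j `|S i j| * (K * x i ^+ 2 + K^-1 * y j ^+ 2) =
    \sum_i (\sum_j `|S i j|) * (K * x i ^+ 2) + \sum_j (\sum_i `|S i j|) * (K^-1 * y j ^+ 2).
  rewrite [X in _ = _ + X](eq_bigr (fun j => \sum_i `|S i j| * (K^-1 * y j ^+ 2))); last first.
    by move=> j _; rewrite mulr_suml.
  rewrite [X in _ = _ + X]exchange_big -big_split; apply: eq_bigr => i _ /=.
  by rewrite mulr_suml -big_split; apply: eq_bigr => j _ /=; rewrite mulrDr.
rewrite mulrDr !mulr_sumr; apply: lerD; apply: ler_sum => i _.
  by apply: ler_wpM2r (hr i); rewrite mulr_ge0 ?sqr_ge0 ?ltW.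
by apply: ler_wpM2r (hc i); rewrite mulr_ge0 ?sqr_ge0 ?invr_ge0 ?ltW.
Qed.

Definition conv (h w : nat -> R) (j : nat) : R := \sum_(i < j.+1) h (j - i)%N * w i.

Lemma eq_conv h v w j : (forall i, (i <= j)%N -> v i = w i) -> conv h v j = conv h w j.
Proof. by move=> e; apply: eq_bigr => i _; rewrite e // -ltnS. Qed.

Lemma conv_recr h w j : conv h w j = \sum_(i < j) h (j - i)%N * w i + h 0%N * w j.
Proof. by rewrite /conv big_ord_recr /= subnn. Qed.

Lemma convE h w (T b : nat) : (b < T)%N ->
  conv h w b = \sum_(c < T) (if (c <= b)%N then h (b - c)%N else 0) * w c.
Proof.
move=> bT; rewrite /conv (big_ord_widen T (fun i => h (b - i)%N * w i)) // big_mkcond /=.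
by apply: eq_bigr => c _; rewrite ltnS; case: ifP => //; rewrite mul0r.
Qed.

(** Young's inequality, by Schur's test.  Both sides have the same horizon T because
    convolution is causal. *)
Lemma conv_bound (h : nat -> R) (gamma : R) T w : 0 < gamma ->
  (forall N, \sum_(j < N) `|h j| <= gamma) ->
  sqn T (conv h w) <= gamma ^+ 2 * sqn T w.
Proof.
move=> g0 hg.
pose S (b c : 'I_T) : R := if (c <= b)%N then h (b - c)%N else 0.
have rows b : \sum_c `|S b c| <= gamma.
  rewrite (eq_bigr (fun c : 'I_T => if (c < b.+1)%N then `|h (b - c)%N| else 0)); last first.
    by move=> c _; rewrite ltnS /S; case: ifP; rewrite ?normr0.
  rewrite -big_mkcond -(big_ord_widen T (fun c => `|h (b - c)%N|)) //.
  rewrite (reindex_inj rev_ord_inj) /=; apply: le_trans (hg b.+1).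
  by apply: ler_sum => i _; rewrite subSS subKn // -ltnS.
have cols c : \sum_b `|S b c| <= gamma.
  apply: le_trans (hg (T - c)%N).
  rewrite -(big_mkord xpredT (fun b => `|if (c <= b)%N then h (b - c)%N else 0|)).
  rewrite (big_cat_nat (n := c)) //=; last exact: ltnW.
  rewrite [X in X + _]big_nat_cond [X in X + _]big1 ?add0r; last first.
    by move=> b /andP[/andP[_ lt] _]; rewrite leqNgt lt /= normr0.
  rewrite -{1}[val c]add0n big_addn big_mkord.
  by apply: ler_sum => i _; rewrite leq_addl addnK.
have := @schur_test _ _ S gamma gamma^-1 (fun b => conv h w b) (fun c => w c) _ rows cols.
rewrite invr_gt0 => /(_ g0); rewrite invrK.
have -> : \sum_i \sum_j S i j * conv h w i * w j = sqn T (conv h w).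
  apply: eq_bigr => b _; rewrite expr2 {3}(convE h w (ltn_ord b)) mulr_sumr.
  by apply: eq_bigr => c _; rewrite /S; ring.
rewrite ger0_norm ?sqn_ge0 // -/(sqn T (conv h w)) -/(sqn T w) mulrDr mulrA divff ?gt_eqF // mul1r mulrA -expr2.
lra.
Qed.

End FiniteForms.

(** A series of nonnegative terms with bounded partial sums is small on
    arbitrarily late windows of any fixed length: otherwise infinitely many
    disjoint windows would each contribute at least eta. *)
Lemma late_window (R : archiRealFieldType) (x : nat -> R) (Q eta : R) (n T0 : nat) :
  (forall a, 0 <= x a) -> (forall N, \sum_(a < N) x a <= Q) -> 0 < eta ->
  exists2 T, (T0 <= T)%N & \sum_(s < n) x (T + s)%N <= eta.
Proof.
move=> x0 hQ e0.
pose W i := \sum_(s < n) x (T0 + i * n + s)%N.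
have sumW i : \sum_(a < T0 + i * n) x a = \sum_(a < T0) x a + \sum_(j < i) W j.
  elim: i => [|i IH]; first by rewrite mul0n addn0 big_ord0 addr0.
  rewrite big_ord_recr /= addrA -IH mulSn [(n + _)%N]addnC addnA.
  rewrite -!(big_mkord xpredT x) (big_cat_nat (n := (T0 + i * n)%N)) ?leq_addr //=.
  congr (_ + _); rewrite -{1}[(T0 + i * n)%N]add0n big_addn addKn big_mkord.
  by apply: eq_bigr => s _; rewrite addnC.
have [k hk] : exists k, Q < eta *+ k.
  exists (Num.bound (Q / eta)); rewrite -[_ *+ _]mulr_natr mulrC -ltr_pdivrMr //.
  by apply: archi_boundP; rewrite divr_ge0 ?(ltW e0) //; have := hQ 0%N; rewrite big_ord0.
have [i hi] : exists i : 'I_k, W i <= eta.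
  apply/existsP; apply: contraLR hk; rewrite negb_exists => /forallP hW.
  rewrite -leNgt; apply: le_trans (hQ (T0 + k * n)%N); rewrite sumW.
  apply: (@le_trans _ _ (\sum_(j < k) W j)); last by rewrite lerDr sumr_ge0.
  rewrite -[in X in X <= _](card_ord k) -sumr_const; apply: ler_sum => j _.
  by have := hW j; rewrite -ltNge => /ltW.
by exists (T0 + i * n)%N; rewrite ?leq_addr.
Qed.

(** * The Zames-Falb inequality on finite sections *)

Section Multiplier.
Context {R : realFieldType}.
Implicit Types (x y u v w : nat -> R).

(** The finite section, on indices below T, of the correlation of u with y at
    lag r - nf. *)
Definition corr (nf T r : nat) u y : R :=
  \sum_(a < T) \sum_(b < T) (a + nf == b + r)%N%:R * u a * y b.

Lemma corr0 nf T u y : corr nf T nf u y = \sum_(a < T) u a * y a.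
Proof.
apply: eq_bigr => a _; have := sum_ord_delta T a (fun b => u a * y b).
rewrite ltn_ord mul1r => <-; apply: eq_bigr => b _.
by rewrite eqn_add2r mulrA.
Qed.

Lemma sum_shift_le1 (T c r : nat) : \sum_(b < T) `|(c == b + r)%N%:R : R| <= 1.
Proof.
case: (leqP r c) => rc; last first.
  rewrite big1 ?ler01 // => b _; suff /negbTE -> : c != (b + r)%N by rewrite normr0.
  lia.
rewrite (eq_bigr (fun b : 'I_T => ((c - r)%N == b)%:R * 1)); last first.
  by move=> b _; rewrite normr_nat mulr1; congr (nat_of_bool _)%:R; lia.
by rewrite (sum_ord_delta T (c - r) (fun=> 1)) mulr1 lern1; case: (_ < _)%N.
Qed.

Lemma corr_bound nf T r u y (K : R) : 0 < K ->
  2 * `|corr nf T r u y| <= K * sqn T u + K^-1 * sqn T y.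
Proof.
move=> K0; rewrite -[leRHS]mul1r.
apply: (@schur_test _ _ _ (fun a b : 'I_T => (a + nf == b + r)%N%:R) 1 K
  (fun a => u a) (fun b => y b)) => // [a|b]; first exact: sum_shift_le1.
by under eq_bigr do rewrite eq_sym; apply: sum_shift_le1.
Qed.

(** A primitive of y with respect to u along a finite increasing chain of points;
    it exists because u and y increase together. *)
Lemma chain_potential (u y : R -> R) (s : seq R) :
  {homo u : a b / a <= b} -> {homo y : a b / a <= b} -> sorted >=%R s ->
  exists F : R -> R, {in s &, forall a b, y b * (u a - u b) <= F a - F b}.
Proof.
move=> hu hy; elim: s => [|c [|d s] IH] /=; first by exists (fun=> 0).
  by exists (fun=> 0) => a b /[!inE] /eqP -> /eqP ->; rewrite subrr mulr0 subrr.
move=> /andP[dc srt]; have [F hF] := IH srt.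
case: (boolP (c \in d :: s)) => [cin|cnin].
  by exists F => a b; rewrite ![_ \in _ :: _ :: _]in_cons => ain bin; apply: hF;
    [case/orP: ain => [/eqP ->|]|case/orP: bin => [/eqP ->|]].
exists (fun a => if a == c then F d + y d * (u c - u d) else F a) => a b.
have dmax e : e \in d :: s -> e <= d.
  rewrite inE => /orP[/eqP -> //|es].
  by have /allP := order_path_min (rev_trans (@le_trans _ R)) srt; apply.
have dd : d \in d :: s by rewrite inE eqxx.
have ne e : e \in d :: s -> (e == c) = false.
  by move=> es; apply/negbTE; apply: contra cnin => /eqP <-.
rewrite ![_ \in c :: _]in_cons => /orP[/eqP ->|ain] /orP[/eqP ->|bin].
- by rewrite !subrr mulr0.
- rewrite eqxx ne //; have := hF d b dd bin.
  have := hy _ _ (dmax b bin); have := hu _ _ dc => h1 h2 h3.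
  have : 0 <= (y d - y b) * (u c - u d) by rewrite mulr_ge0 ?subr_ge0.
  lra.
- rewrite eqxx ne //; have := hF a d ain dd.
  have := hy _ _ dc; have := hu _ _ dc; have := hu _ _ (dmax a ain) => h1 h2 h3 h4.
  have : 0 <= (y c - y d) * (u c - u a) by rewrite mulr_ge0 ?subr_ge0 // (le_trans h1).
  lra.
- by rewrite !ne //; apply: hF.
Qed.

(** Rearrangement inequality for a substochastic matrix S, which stands in for
    the permutation: the potential of the chain formed by 0 and the v a turns the
    cyclic sums into telescoping ones. *)
Lemma substochastic_rearrangement (u y : R -> R) (T : nat) v
    (S : 'I_T -> 'I_T -> R) :
  {homo u : a b / a <= b} -> {homo y : a b / a <= b} -> u 0 = 0 -> y 0 = 0 ->
  (forall a b, 0 <= S a b) ->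
  (forall a, \sum_b S a b <= 1) -> (forall b, \sum_a S a b <= 1) ->
  \sum_a \sum_b S a b * u (v a) * y (v b) <= \sum_(a < T) u (v a) * y (v a).
Proof.
move=> hu hy u0 y0 S0 rows cols.
pose s := sort >=%R (0 :: [seq v a | a <- iota 0 T]).
have [F0 hF0] := @chain_potential u y s hu hy (sort_sorted (fun a b => le_total b a) _).
have s0 : 0 \in s by rewrite mem_sort inE eqxx.
have sv (a : 'I_T) : v a \in s.
  by rewrite mem_sort inE map_f ?orbT // mem_iota /=.
pose F a := F0 a - F0 0.
have hF a b : a \in s -> b \in s -> y b * (u a - u b) <= F a - F b.
  by move=> ain bin; rewrite /F opprB addrA subrK; apply: hF0.
have F00 : F 0 = 0 by rewrite /F subrr.
have Fge (a : 'I_T) : 0 <= F (v a).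
  by have := hF _ _ (sv a) s0; rewrite y0 mul0r F00 subr0.
have Fle (a : 'I_T) : F (v a) <= u (v a) * y (v a).
  by have := hF _ _ s0 (sv a); rewrite u0 F00 !sub0r mulrN lerN2 mulrC.
apply: (@le_trans _ _ (\sum_a \sum_b S a b * F (v a) +
   \sum_b \sum_a S a b * (u (v b) * y (v b) - F (v b)))).
  rewrite [X in _ + X]exchange_big -big_split; apply: ler_sum => a _ /=.
  rewrite -big_split; apply: ler_sum => b _ /=.
  rewrite -mulrA -mulrDr ler_wpM2l //.
  by have := hF _ _ (sv a) (sv b); lra.
rewrite -[leRHS](@subrK _ (\sum_(a < T) F (v a))) -sumrB addrC.
apply: lerD; apply: ler_sum => a _; rewrite -mulr_suml ler_piMl //.
by rewrite subr_ge0.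
Qed.

Lemma corr_rearrangement (u y : R -> R) nf T r v :
  {homo u : a b / a <= b} -> {homo y : a b / a <= b} -> u 0 = 0 -> y 0 = 0 ->
  corr nf T r (u \o v) (y \o v) <= \sum_(a < T) u (v a) * y (v a).
Proof.
move=> hu hy u0 y0.
apply: (@substochastic_rearrangement u y T v (fun a b : 'I_T => (a + nf == b + r)%N%:R)) => //.
  move=> a; apply: le_trans (sum_shift_le1 T (a + nf) r).
  by apply: ler_sum => b _; rewrite normr_nat.
move=> b; apply: le_trans (sum_shift_le1 T (b + r) nf).
by apply: ler_sum => a _; rewrite normr_nat eq_sym.
Qed.

Variables (nf L : nat) (m : 'I_L -> R).

(** The finite section of the pairing of u with the filtered signal m * y. *)
Definition zform (T : nat) u y : R := \sum_r m r * corr nf T r u y.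

Definition mass : R := \sum_r `|m r|.

Lemma zform_bound T u y (K : R) : 0 < K ->
  2 * `|zform T u y| <= mass * (K * sqn T u + K^-1 * sqn T y).
Proof.
move=> K0; rewrite /mass mulr_suml.
apply: (@le_trans _ _ (2 * \sum_r `|m r * corr nf T r u y|)).
  by rewrite ler_pM2l // ler_norm_sum.
rewrite mulr_sumr; apply: ler_sum => r _; rewrite normrM mulrCA ler_wpM2l //.
exact: corr_bound.
Qed.

Lemma zformE T u y :
  zform T u y = \sum_(a < T) u a * (\sum_r m r * \sum_(b < T) (a + nf == b + r)%N%:R * y b).
Proof.
under [RHS]eq_bigr => a _.
  rewrite mulr_sumr; under eq_bigr do rewrite mulrCA.
over.
rewrite exchange_big; apply: eq_bigr => r _; rewrite -mulr_sumr; congr (_ * _).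
apply: eq_bigr => a _; rewrite mulr_sumr; apply: eq_bigr => b _; ring.
Qed.

Lemma eq_zform T u u' y y' : (forall a, (a < T)%N -> u a = u' a) ->
  (forall a, (a < T)%N -> y a = y' a) -> zform T u y = zform T u' y'.
Proof.
move=> eu ey; apply: eq_bigr => r _; congr (_ * _).
by apply: eq_bigr => a _; apply: eq_bigr => b _; rewrite eu // ey.
Qed.

Lemma zform_lin1 T c u u' y :
  zform T (fun a => c * u a + u' a) y = c * zform T u y + zform T u' y.
Proof.
rewrite !zformE mulr_sumr -big_split; apply: eq_bigr => a _ /=.
by rewrite mulrDl mulrA.
Qed.

Lemma zform_lin2 T c u y y' :
  zform T u (fun a => c * y a + y' a) = c * zform T u y + zform T u y'.
Proof.
rewrite mulr_sumr -big_split; apply: eq_bigr => r _ /=.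
rewrite mulrCA -mulrDr; congr (_ * _).
rewrite mulr_sumr -big_split; apply: eq_bigr => a _ /=.
rewrite mulr_sumr -big_split; apply: eq_bigr => b _ /=; ring.
Qed.

Hypothesis m0 : forall r : 'I_L, r = nf :> nat -> m r = 1.
Hypothesis nfL : (nf < L)%N.
Let r0 := Ordinal nfL.

Lemma zform_split T u y : zform T u y =
  \sum_(a < T) u a * y a + \sum_(r | r != r0) m r * corr nf T r u y.
Proof. by rewrite /zform (bigD1 r0) //= m0 // mul1r corr0. Qed.

Lemma mass_split : mass = 1 + \sum_(r | r != r0) `|m r|.
Proof. by rewrite /mass (bigD1 r0) //= m0 // normr1. Qed.

Lemma zform_coercive T w :
  (1 - \sum_(r | r != r0) `|m r|) * sqn T w <= zform T w w.
Proof.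
rewrite zform_split mulrBl mul1r; under [X in _ <= X + _]eq_bigr do rewrite -expr2.
rewrite -/(sqn T w) lerD2l lerNl -sumrN mulr_suml; apply: ler_sum => r _.
apply: le_trans (ler_norm _) _; rewrite normrN normrM ler_wpM2l //.
by have := corr_bound nf T r w w ltr01; rewrite invr1; lra.
Qed.

(** The Zames-Falb inequality for finite sections.  Each correlation is at most
    the zero-lag one, by rearrangement; for odd nonlinearities the same holds of
    its absolute value, by rearrangement of the absolute values. *)
Lemma zames_falb (u y : R -> R) T v :
  {homo u : a b / a <= b} -> {homo y : a b / a <= b} -> u 0 = 0 -> y 0 = 0 ->
  \sum_(r | r != r0) `|m r| <= 1 ->
  (forall r, r != r0 -> m r <= 0) \/ ((forall a, u (- a) = - u a) /\ (forall a, y (- a) = - y a)) ->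
  0 <= zform T (u \o v) (y \o v).
Proof.
move=> hu hy u0 y0 hm hcl; rewrite zform_split /=.
have uy_ge0 b : 0 <= u b * y b.
  case: (leP 0 b) => [|/ltW] b0; have := hy _ _ b0; have := hu _ _ b0; rewrite u0 y0 => h1 h2.
    exact: mulr_ge0.
  exact: mulr_le0.
set P := \sum_(a < T) _.
have P0 : 0 <= P by apply: sumr_ge0.
suff : - \sum_(r | r != r0) `|m r| * P <= \sum_(r | r != r0) m r * corr nf T r (u \o v) (y \o v).
  by have : 0 <= P - (\sum_(r | r != r0) `|m r|) * P;
    [rewrite -{1}[P]mul1r -mulrBl mulr_ge0 // subr_ge0|rewrite mulr_suml; lra].
rewrite -sumrN; apply: ler_sum => r rr.
case: hcl => [/(_ r rr) mr|[ou oy]].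
  rewrite ler0_norm // mulNr opprK.
  by apply: ler_wnM2l => //; apply: corr_rearrangement.
rewrite lerNl; apply: le_trans (ler_norm _) _; rewrite normrN normrM ler_wpM2l //.
have absodd (f : R -> R) : {homo f : a b / a <= b} -> f 0 = 0 ->
      (forall a, f (- a) = - f a) ->
    forall b, `|f b| = f `|b|.
  move=> hf f0 fo b; case: (leP 0 b) => [b0|b0].
    by rewrite !ger0_norm // -f0; apply: hf.
  by rewrite (ltr0_norm b0) fo ler0_norm // -f0; apply: hf; apply: ltW.
apply: (@le_trans _ _ (corr nf T r (u \o (fun a => `|v a|)) (y \o (fun a => `|v a|)))).
  apply: le_trans (ler_norm_sum _ _ _) _; apply: ler_sum => a _.
  apply: le_trans (ler_norm_sum _ _ _) _; apply: ler_sum => b _.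
  by rewrite !normrM normr_nat /= !absodd.
apply: le_trans (corr_rearrangement _ _ _ _ hu hy u0 y0) _.
apply: ler_sum => a _; rewrite -(absodd u) // -(absodd y) // -normrM ger0_norm //.
Qed.

End Multiplier.

(** * From the unit circle to finite signals *)

Section CircleToSignals.
Context {R : rcfType}.
Local Notation C := R[i].
Local Open Scope complex_scope.

Lemma ReD (x y : C) : complex.Re (x + y) = complex.Re x + complex.Re y.
Proof. by case: x => a b; case: y. Qed.

Lemma ReN (x : C) : complex.Re (- x) = - complex.Re x.
Proof. by case: x. Qed.

Lemma Re_sum (I : Type) (s : seq I) (P : pred I) (F : I -> C) :
  complex.Re (\sum_(i <- s | P i) F i) = \sum_(i <- s | P i) complex.Re (F i).
Proof. exact: (big_morph _ ReD). Qed.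

Lemma ReZ (a : R) (x : C) : complex.Re (a%:C * x) = a * complex.Re x.
Proof. by case: x => b c /=; rewrite mul0r subr0. Qed.

Lemma ReZr (a : R) (x : C) : complex.Re (x * a%:C) = complex.Re x * a.
Proof. by rewrite mulrC ReZ mulrC. Qed.

Lemma conjcZ (a : R) (x : C) : (a%:C * x)^*%C = a%:C * x^*%C.
Proof. by rewrite rmorphM; congr (_ * _); exact: conjc_real. Qed.

Lemma conjcX (x : C) (j : nat) : (x ^+ j)^*%C = x^*%C ^+ j.
Proof. exact: rmorphXn. Qed.

Lemma norm_real_complex (a : R) : `|a%:C| = `|a|%:C.
Proof. by rewrite normc_def /= expr0n addr0 sqrtr_sqr. Qed.

Lemma Re_ge_norm (x : C) (b : R) : `|x| <= b%:C -> - b <= complex.Re x.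
Proof.
by move=> xb; have := le_trans (normc_ge_Re x) xb; rewrite lecR ler_norml => /andP[].
Qed.

Lemma prim_root_complex (N : nat) : (0 < N)%N -> exists z : C, N.-primitive_root z.
Proof.
move=> N0; pose p : {poly C} := 'X^N - 1.
have [r dp] := closed_field_poly_normal p.
rewrite (monicP (monic_Xn_sub_1 _ N0)) scale1r in dp.
have : has N.-primitive_root r; last by case/hasP=> z _ zp; exists z.
apply: cyclic.has_prim_root => //.
- by apply/allP => x xr; rewrite /root_of_unity -/p dp root_prod_XsubC.
- rewrite -separable.separable_prod_XsubC -dp cyclotomic.separable_Xn_sub_1 //.
  by rewrite pnatr_eq0 -lt0n.
- by rewrite -ltnS -(size_prod_XsubC r id) -dp size_Xn_sub_1.
Qed.

Lemma unit_circle_mulJ (z : C) : `|z| = 1 -> z * z^*%C = 1.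
Proof. by move=> z1; rewrite -sqr_normc z1 expr1n. Qed.

Lemma unity_root_norm (N : nat) (z : C) : (0 < N)%N -> z ^+ N = 1 -> `|z| = 1.
Proof.
move=> N0 zN; apply/eqP; rewrite -(@pexpr_eq1 _ _ N) ?normr_ge0 //.
by rewrite -normrX zN normr1.
Qed.

Lemma dft_orthogonal (N A B : nat) (z : C) : N.-primitive_root z ->
  (A < N)%N -> (B < N)%N ->
  \sum_(l < N) (z ^+ l) ^+ A * ((z ^+ l) ^+ B)^*%C = (A == B)%:R * N%:R.
Proof.
move=> zp AN BN; have zN := prim_expr_order zp.
have N0 : (0 < N)%N by apply: leq_ltn_trans AN.
have zJ := unit_circle_mulJ (unity_root_norm N0 zN).
pose q := z ^+ A * z^*%C ^+ B.
rewrite (eq_bigr (fun l : 'I_N => q ^+ l)); last first.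
  move=> l _; rewrite /q exprMn !rmorphXn /= -!exprM; congr (_ ^+ _ * _ ^+ _); lia.
case: eqP => [AB|/eqP AB].
  rewrite mul1r (eq_bigr (fun=> 1)) ?sumr_const ?card_ord // => l _.
  by rewrite /q AB -exprMn zJ !expr1n.
rewrite mul0r; apply/eqP.
have q1 : q - 1 != 0.
  rewrite subr_eq0; apply: contra AB => /eqP q1.
  have : z ^+ A = z ^+ B.
    by rewrite -[RHS]mul1r -q1 /q -mulrA -exprMn [_^*%C * _]mulrC zJ expr1n mulr1.
  by move/eqP; rewrite (eq_prim_root_expr zp) !modn_small.
rewrite -(mulrI_eq0 _ (lregP q1)) -subrX1 /q exprMn -!exprM ![(_ * N)%N]mulnC !exprM.
by rewrite -rmorphXn /= zN rmorph1 !expr1n mulr1 subrr.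
Qed.

(** Parseval's identity, for two trigonometric polynomials whose exponents are
    below the number N of sample points. *)
Lemma dft_pairing (N : nat) (z : C) (I J : finType) (al : I -> C) (be : J -> C)
    (A : I -> nat) (B : J -> nat) : N.-primitive_root z ->
  (forall i, (A i < N)%N) -> (forall j, (B j < N)%N) ->
  \sum_(l < N) (\sum_i al i * (z ^+ l) ^+ A i) * (\sum_j be j * (z ^+ l) ^+ B j)^*%C =
  N%:R * \sum_i \sum_j (A i == B j)%:R * al i * (be j)^*%C.
Proof.
move=> zp hA hB.
transitivity (\sum_(l < N) \sum_i \sum_j
   (al i * (be j)^*%C) * ((z ^+ l) ^+ A i * ((z ^+ l) ^+ B j)^*%C)).
  apply: eq_bigr => l _; rewrite mulr_suml; apply: eq_bigr => i _.
  rewrite rmorph_sum mulr_sumr; apply: eq_bigr => j _ /=.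
  by rewrite rmorphM /= mulrACA.
rewrite exchange_big mulr_sumr; apply: eq_bigr => i _ /=.
rewrite exchange_big mulr_sumr; apply: eq_bigr => j _ /=.
rewrite -mulr_sumr (dft_orthogonal zp) //; ring.
Qed.

Variables (nf L : nat) (m : 'I_L -> R) (p : nat -> R) (eps : R).

(** The frequency response of the multiplier times that of a truncated kernel;
    on the unit circle conjugation inverts z. *)
Definition circle_response (K : nat) (z : C) : C :=
  (\sum_r (m r)%:C * (z ^+ nf * z^*%C ^+ r)) * (\sum_(j < K) (p j)%:C * z^*%C ^+ j).

Lemma conv_delta (w : nat -> R) (T K b : nat) : (b < T)%N -> (T <= K)%N ->
  conv p w b = \sum_(c < T) \sum_(j < K) (b == c + j)%N%:R * (p j * w c).
Proof.
move=> bT TK; rewrite (convE p w bT); apply: eq_bigr => c _.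
case: leqP => cb.
  rewrite (eq_bigr (fun j : 'I_K => ((b - c)%N == j)%:R * (p j * w c))); last first.
    by move=> j _; congr ((nat_of_bool _)%:R * _); lia.
  by rewrite (sum_ord_delta K (b - c) (fun j => p j * w c)) (_ : (_ < K)%N) ?mul1r //; lia.
rewrite mul0r big1 // => j _; suff /negbTE -> : b != (c + j)%N by rewrite mul0r.
by lia.
Qed.

Lemma zform_conv (T K : nat) (w : nat -> R) :
  (forall i, (T <= i)%N -> w i = 0) -> (T + nf <= K)%N ->
  zform nf m (T + nf) w (conv p w) =
  \sum_(a < T + nf) \sum_(t : 'I_L * ('I_K * 'I_(T + nf)))
    (a + nf == t.1 + (t.2.1 + t.2.2))%N%:R * w a * (m t.1 * (p t.2.1 * w t.2.2)).
Proof.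
move=> w0 TK; rewrite zformE; apply: eq_bigr => a _.
case: (leqP T a) => [/w0 wa0|aT].
  by rewrite wa0 mul0r big1 // => t _; rewrite mulr0 mul0r.
rewrite -(pair_bigA _ (fun (r : 'I_L) (q : 'I_K * 'I_(T + nf)) =>
  (a + nf == r + (q.1 + q.2))%N%:R * w a * (m r * (p q.1 * w q.2)))) /= mulr_sumr.
apply: eq_bigr => r _; rewrite -(pair_bigA _ (fun (j : 'I_K) (c : 'I_(T + nf)) =>
  (a + nf == r + (j + c))%N%:R * w a * (m r * (p j * w c)))) /=.
transitivity (w a * (m r * \sum_(b < T + nf) \sum_(c < T + nf) \sum_(j < K)
    (c + j == b)%N%:R * ((a + nf == b + r)%N%:R * (p j * w c)))).
  congr (_ * (_ * _)); apply: eq_bigr => b _.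
  rewrite (conv_delta w (ltn_ord b) TK) mulr_sumr; apply: eq_bigr => c _.
  by rewrite mulr_sumr; apply: eq_bigr => j _; rewrite mulrCA; congr (_ * _); rewrite eq_sym.
rewrite exchange_big [RHS]exchange_big !mulr_sumr; apply: eq_bigr => c _ /=.
rewrite exchange_big !mulr_sumr; apply: eq_bigr => j _ /=.
rewrite (sum_ord_delta (T + nf) (c + j) (fun b => (a + nf == b + r)%N%:R * (p j * w c))).
rewrite [(r + _)%N]addnC [(j + c)%N]addnC.
case: ltnP => cj; first by rewrite mul1r; ring.
suff /negbTE -> : (a + nf)%N != (c + j + r)%N by rewrite !mul0r !mulr0.
by lia.
Qed.

(** Positivity of the frequency response on the circle gives positivity on finite
    signals: with more sample points than the degrees involved, the quadratic form
    is exactly the average of response times squared transform. *)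
Lemma positive_on_signals (T : nat) (w : nat -> R) :
  (forall i, (T <= i)%N -> w i = 0) ->
  (exists2 K, (T + nf <= K)%N &
     forall z : C, `|z| = 1 -> eps <= complex.Re (circle_response K z)) ->
  eps * sqn T w <= zform nf m (T + nf) w (conv p w).
Proof.
move=> w0 [K TK hK]; set T' := (T + nf)%N.
pose N := (T' + nf + L + K).+1.
have [z zp] := prim_root_complex (ltn0Sn (T' + nf + L + K)).
have zN := prim_expr_order zp.
have norm1 l : `|z ^+ l| = 1 :> C.
  by rewrite normrX (unity_root_norm (ltn0Sn _) zN) expr1n.
pose W (x : C) := \sum_(a < T') (w a)%:C * x ^+ a.
pose E (x : C) := complex.Re (W x * (W x)^*%C).
have WE x : W x * (W x)^*%C = (E x)%:C.
  by rewrite /E -sqr_normc -add_Re2_Im2.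
have E0 x : 0 <= E x by rewrite -ler0c -WE mulcJ_ge0.
have e1 : sqn T w * N%:R = \sum_(l < N) E (z ^+ l).
  have -> : sqn T w = sqn T' w.
    rewrite -[LHS](sum_ord_trunc T nf (fun a => w a ^+ 2)); apply: eq_bigr => a _.
    by case: ltnP => // /w0 ->; rewrite expr0n.
  have := @dft_pairing N z _ _ (fun a : 'I_T' => (w a)%:C) (fun a : 'I_T' => (w a)%:C)
    (fun a => a) (fun a => a) zp ltac:(move=> a; have := ltn_ord a; rewrite /N /=; lia) ltac:(move=> a; have := ltn_ord a; rewrite /N /=; lia).
  rewrite (eq_bigr (fun l : 'I_N => (E (z ^+ l))%:C)); last by move=> l _; rewrite -WE.
  rewrite -rmorph_sum => /(congr1 (@complex.Re R)); rewrite [X in X = _ -> _]/= => ->.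
  rewrite -[N%:R]/((N.-1.+1)%:R) -(rmorph_nat (real_complex R)) ReZ mulrC; congr (_ * _).
  rewrite Re_sum; apply: eq_bigr => a _; rewrite Re_sum.
  rewrite (eq_bigr (fun b : 'I_T' => (nat_of_ord a == b)%:R * (w a * w b))); last first.
    by move=> b _; rewrite conjc_real -(rmorph_nat (real_complex R)) -!rmorphM /= mulrA.
  by rewrite (sum_ord_delta T' a (fun b => w a * w b)) ltn_ord mul1r expr2.
have e2 : zform nf m T' w (conv p w) * N%:R =
    \sum_(l < N) E (z ^+ l) * complex.Re (circle_response K (z ^+ l)).
  have := @dft_pairing N z _ _ (fun a : 'I_T' => (w a)%:C)
    (fun t : 'I_L * ('I_K * 'I_T') => (m t.1 * (p t.2.1 * w t.2.2))%:C)
    (fun a => (a + nf)%N) (fun t => (t.1 + (t.2.1 + t.2.2))%N) zp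
    ltac:(move=> a; have := ltn_ord a; rewrite /N /=; lia)
    ltac:(move=> [r [j c]]; have := ltn_ord r; have := ltn_ord j; have := ltn_ord c; rewrite /N /=; lia).
  rewrite (eq_bigr (fun l : 'I_N => (E (z ^+ l))%:C * circle_response K (z ^+ l))); last first.
    move=> l _; set x := z ^+ l.
    have -> : \sum_(a < T') (w a)%:C * x ^+ (a + nf) = W x * x ^+ nf.
      by rewrite mulr_suml; apply: eq_bigr => a _; rewrite exprD mulrA.
    have -> : (\sum_(t : 'I_L * ('I_K * 'I_T'))
        (m t.1 * (p t.2.1 * w t.2.2))%:C * x ^+ (t.1 + (t.2.1 + t.2.2)))^*%C =
        (\sum_r (m r)%:C * x^*%C ^+ r) * ((\sum_(j < K) (p j)%:C * x^*%C ^+ j) * (W x)^*%C).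
      rewrite -(pair_bigA _ (fun (r : 'I_L) (q : 'I_K * 'I_T') =>
        (m r * (p q.1 * w q.2))%:C * x ^+ (r + (q.1 + q.2)))) /= rmorph_sum mulr_suml.
      apply: eq_bigr => r _; rewrite -(pair_bigA _ (fun (j : 'I_K) (c : 'I_T') =>
        (m r * (p j * w c))%:C * x ^+ (r + (j + c)))) /= rmorph_sum mulr_suml mulr_sumr.
      apply: eq_bigr => j _; rewrite /W !rmorph_sum /= !mulr_sumr; apply: eq_bigr => c _.
      rewrite !conjcZ !conjcX !(rmorphM (real_complex R)) !exprD; ring.
    rewrite -WE /circle_response.
    have -> : \sum_r (m r)%:C * (x ^+ nf * x^*%C ^+ r) = x ^+ nf * \sum_r (m r)%:C * x^*%C ^+ r.
      by rewrite mulr_sumr; apply: eq_bigr => r _; rewrite mulrCA.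
    ring.
  move=> /(congr1 (@complex.Re R)); rewrite Re_sum.
  rewrite (eq_bigr (fun l : 'I_N => E (z ^+ l) * complex.Re (circle_response K (z ^+ l)))); last first.
    by move=> l _; rewrite ReZ.
  move=> ->; rewrite -(rmorph_nat (real_complex R)) ReZ mulrC; congr (_ * _).
  rewrite (zform_conv w0 TK) Re_sum; apply: eq_bigr => a _; rewrite Re_sum.
  apply: eq_bigr => t _.
  by rewrite conjc_real -(rmorph_nat (real_complex R)) -!rmorphM.
have N0 : 0 < N%:R :> R by rewrite ltr0n.
rewrite -(ler_pM2r N0) -mulrA e1 e2 mulr_sumr; apply: ler_sum => l _.
by rewrite mulrC ler_wpM2l // hK.
Qed.

End CircleToSignals.

(** * Expansion of a stable rational function at infinity *)

Section LongDivision.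
Context {F : fieldType}.
Implicit Types (A q : {poly F}).

(** The j-th coefficient of the expansion of A / q at infinity. *)
Definition expansion A q (j : nat) : F := (('X^j * A) %/ q)`_0.

Lemma divp_shift A q : q != 0 ->
  ('X * A) %/ q = 'X * (A %/ q) + ((('X * A) %/ q)`_0)%:P.
Proof.
move=> q0; pose r := A %% q.
have e : ('X * A) %/ q = 'X * (A %/ q) + ('X * r) %/ q.
  by rewrite {1}(divp_eq A q) mulrDr mulrA divp_addl_mul.
have s1 : (size (('X * r) %/ q)%R <= 1)%N.
  rewrite size_divp // leq_subLR; have := ltn_modpN0 A q0; rewrite -/r => rq.
  apply: leq_trans (size_polyMleq _ _) _; rewrite size_polyX add2n succnK.
  by rewrite addn1 prednK // size_poly_gt0.
by rewrite e coefD coefXM add0r [in LHS](size1_polyC s1).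
Qed.

Lemma quotient_step A q j : q != 0 ->
  ('X^(j.+1) * A) %/ q = 'X * (('X^j * A) %/ q) + (expansion A q j.+1)%:P.
Proof. by move=> q0; rewrite /expansion exprS -mulrA; exact: divp_shift. Qed.

Lemma remainder_step A q j : q != 0 ->
  ('X^(j.+1) * A) %% q = 'X * (('X^j * A) %% q) - expansion A q j.+1 *: q.
Proof.
move=> q0; have := divp_eq ('X^(j.+1) * A) q; rewrite quotient_step //.
have := divp_eq ('X^j * A) q => e1.
rewrite {1}exprS -mulrA {1}e1 mulrDr mulrDl mulrA -mul_polyC -addrA => /addrI ->.
by rewrite addrAC subrr add0r.
Qed.

Lemma expansion_eval A q (z : F) (K : nat) : q != 0 -> (size A <= size q)%N ->
  z ^+ K * A.[z] =
    q.[z] * (\sum_(i < K.+1) expansion A q i * z ^+ (K - i)) + (('X^K * A) %% q).[z].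
Proof.
move=> q0 sz; have := congr1 (fun P => P.[z]) (divp_eq ('X^K * A) q).
rewrite hornerM hornerXn hornerD hornerM => ->; congr (_ + _); rewrite mulrC; congr (_ * _).
elim: K => [|K IH].
  rewrite big_ord1 subnn mulr1 /expansion expr0 mul1r.
  have s1 : (size (A %/ q)%R <= 1)%N by rewrite size_divp // leq_subLR addn1 prednK // size_poly_gt0.
  by rewrite {1}(size1_polyC s1) hornerC.
rewrite quotient_step // hornerD hornerM hornerX hornerC IH.
rewrite [RHS]big_ord_recr /= subnn mulr1 mulr_sumr; congr (_ + _).
by apply: eq_bigr => i _; rewrite mulrCA -exprS subSn // -ltnS.
Qed.

(** A remainder coefficient is determined by the expansion coefficients that follow
    it: once t reaches the degree of q, the last term vanishes. *)
Lemma remainder_coef A q t K l : q != 0 -> (('X^K * A) %% q)`_l =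
  \sum_(s < t) expansion A q (K.+1 + s) * q`_(l.+1 + s) + (('X^(K + t) * A) %% q)`_(l + t).
Proof.
move=> q0; elim: t => [|t IH]; first by rewrite big_ord0 !addn0 add0r.
rewrite IH big_ord_recr /= -addrA !addnS remainder_step // coefB coefXM coefZ /=.
by rewrite addSn [_ * _ + _]addrC subrK.
Qed.

End LongDivision.

(** The expansion of a stable rational function is absolutely summable, by
    induction on the poles: removing a factor X - lam turns the coefficients into a
    first-order recursion with ratio lam, driven by the shorter expansion. *)
Lemma expansion_roots_l1 (F : numFieldType) (s : seq F) (P : {poly F}) :
  (forall lam, lam \in s -> `|lam| < 1) ->
  exists B, forall T, \sum_(j < T) `|expansion P (\prod_(lam <- s) ('X - lam%:P)) j| <= B.
Proof.
elim: s => [|lam s IH] hs.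
  exists `|P`_0| => T; rewrite big_nil.
  rewrite (eq_bigr (fun j : 'I_T => (0 == j)%N%:R * (fun=> `|P`_0|) j)); last first.
    move=> [[|j] jT] _; rewrite /expansion divp1 /= ?mul1r ?expr0 ?mul1r //.
    by rewrite exprS -mulrA coefXM /= normr0 mul0r.
  case: T => [|T]; first by rewrite big_ord0 normr_ge0.
  by rewrite big_ord_recl /= mul1r big1 ?addr0 // => j _; rewrite mul0r.
have [B hB] := IH (fun x xs => hs x (mem_behead (s := lam :: s) xs)).
have lam1 : `|lam| < 1 by apply: hs; rewrite inE eqxx.
rewrite big_cons; set Q := \prod_(x <- s) _ in hB *.
have Q0 : Q != 0 by rewrite monic_neq0 // monic_prod_XsubC.
pose b j := ('X^j * P) %/ Q.
pose y j := (b j).[lam].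
have yS j : y j.+1 = lam * y j + expansion P Q j.+1.
  by rewrite /y /b quotient_step // hornerD hornerM hornerX hornerC.
have expS j : expansion P (('X - lam%:P) * Q) j.+1 = y j.
  transitivity ((b j.+1 %/ ('X - lam%:P))`_0); first by rewrite /expansion [_ * Q]mulrC -divp_divl.
  have := divp_eq (b j) ('X - lam%:P); rewrite modp_XsubC -/(y j) => bj.
  have -> : b j.+1 = ('X * (b j %/ ('X - lam%:P)) + (y j)%:P) * ('X - lam%:P) +
      (lam * y j + expansion P Q j.+1)%:P.
    rewrite /b quotient_step // -/(b j) {1}bj !polyCD !polyCM; ring.
  rewrite divp_addl_mul_small ?size_XsubC ?size_polyC; last by case: (_ != 0).
  by rewrite coefD coefXM coefC add0r.
have d0 : 0 < 1 - `|lam| by rewrite subr_gt0.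
have B0 : 0 <= B by have := hB 0%N; rewrite big_ord0.
pose E := (`|y 0%N| + B) / (1 - `|lam|).
have hS T : \sum_(j < T) `|y j| <= E.
  have e : \sum_(j < T.+1) `|y j| <= `|y 0%N| + `|lam| * (\sum_(j < T) `|y j|) + B.
    rewrite big_ord_recl -addrA lerD2l.
    apply: (@le_trans _ _ (\sum_(j < T) (`|lam| * `|y j| + `|expansion P Q j.+1|))).
      by apply: ler_sum => j _; rewrite yS -normrM ler_normD.
    rewrite big_split -mulr_sumr lerD2l /=; apply: le_trans (hB T.+1).
    by rewrite [leRHS]big_ord_recl lerDr normr_ge0.
  rewrite /E ler_pdivlMr // mulrBr mulr1 lerBlDr.
  rewrite [_ * `|lam|]mulrC addrAC; apply: le_trans e.
  by rewrite big_ord_recr lerDl normr_ge0.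
exists (`|expansion P (('X - lam%:P) * Q) 0%N| + E) => -[|T].
  by have := hS 0%N; rewrite !big_ord0 => E0; rewrite addr_ge0.
rewrite big_ord_recl lerD2l (eq_bigr (fun j : 'I_T => `|y j|)); first exact: hS.
by move=> j _; rewrite lift0 expS.
Qed.

Section StableExpansion.
Context {R : realType}.
Local Notation C := R[i].
Local Open Scope complex_scope.
Variables (p q : {poly R}).
Hypothesis q0 : q != 0.
Hypothesis q_stable : forall z : C, root (map_poly (real_complex R) q) z -> `|z| < 1.

Let qC := map_poly (real_complex R) q.

Lemma expansion_map j : expansion (map_poly (real_complex R) p) qC j = (expansion p q j)%:C.
Proof.
by rewrite /expansion -(map_polyXn (real_complex R)) -rmorphM /= -map_divp coef_map.
Qed.

Lemma stable_factor : exists s : seq C,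
  qC = lead_coef qC *: \prod_(lam <- s) ('X - lam%:P) /\ (forall lam, lam \in s -> `|lam| < 1).
Proof.
have [s hs] := closed_field_poly_normal qC; exists s; split=> // lam ls.
by apply: q_stable; rewrite -/qC hs rootZ ?lead_coef_eq0 ?map_poly_eq0 // root_prod_XsubC.
Qed.

Lemma expansion_l1 : exists2 gamma : R, 0 < gamma &
  forall N, \sum_(j < N) `|expansion p q j| <= gamma.
Proof.
have [s [qs hs]] := stable_factor.
have lq : (lead_coef qC) != 0 by rewrite lead_coef_eq0 map_poly_eq0.
have [B hB] := @expansion_roots_l1 _ s ((lead_coef qC)^-1 *: map_poly (real_complex R) p) hs.
exists (complex.Re B + 1).
  by rewrite ltr_wpDl //; have := hB 0%N; rewrite big_ord0 lecE => /andP[].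
move=> N; have := hB N; rewrite lecE => /andP[_]; rewrite Re_sum => le.
apply: (@le_trans _ _ (complex.Re B)); last by rewrite lerDl.
apply: le_trans le; apply: ler_sum => j _.
have -> : expansion ((lead_coef qC)^-1 *: map_poly (real_complex R) p)
    (\prod_(lam <- s) ('X - lam%:P)) j = (expansion p q j)%:C.
  have -> : expansion ((lead_coef qC)^-1 *: map_poly (real_complex R) p)
    (\prod_(lam <- s) ('X - lam%:P)) j = expansion (map_poly (real_complex R) p) qC j.
    by rewrite /expansion [in RHS]qs divpZr // -scalerAr divpZl.
  exact: expansion_map.
by rewrite norm_real_complex.
Qed.

Lemma stable_circle_lower : exists2 kappa : R, 0 < kappa &
  forall z : C, `|z| = 1 -> kappa%:C <= `|qC.[z]|.
Proof.
have [s [qs hs]] := stable_factor.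
pose ka : C := `|lead_coef qC| * \prod_(lam <- s) (1 - `|lam|).
have ka0 : 0 < ka.
  rewrite mulr_gt0 ?normr_gt0 ?lead_coef_eq0 ?map_poly_eq0 //.
  by rewrite big_seq; apply: prodr_gt0 => lam ls; rewrite subr_gt0 hs.
have kaE : ka = (complex.Re ka)%:C by apply/esym/RRe_real/gtr0_real.
exists (complex.Re ka); first by move: ka0; rewrite {1}kaE ltcR.
move=> z z1; have -> : qC.[z] = lead_coef qC * (\prod_(lam <- s) ('X - lam%:P)).[z].
  by rewrite {1}qs hornerZ.
rewrite -kaE /ka horner_prod normrM; apply: ler_wpM2l => //.
rewrite normr_prod big_seq [leRHS]big_seq; apply: ler_prod => lam ls.
rewrite subr_ge0 ltW ?hs //= hornerXsubC -z1.
exact: lerB_dist.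
Qed.

(** On the unit circle, arbitrarily long truncations of the expansion approximate
    p / q uniformly: the error is the remainder of the division over q, whose
    coefficients are combinations of a window of later expansion coefficients. *)
Lemma expansion_circle (delta : R) (K0 : nat) : (size p <= size q)%N -> 0 < delta ->
  exists2 K, (K0 <= K)%N & forall z : C, `|z| = 1 ->
    `|\sum_(j < K) (expansion p q j)%:C * z^*%C ^+ j -
      (map_poly (real_complex R) p).[z] / qC.[z]| <= delta%:C.
Proof.
move=> sz d0; have [gam g0 hg] := expansion_l1; have [ka ka0 hk] := stable_circle_lower.
set d := size q.
pose M := 1 + \sum_(m < d) `|q`_m|.
have M0 : 0 < M by rewrite ltr_pwDl // sumr_ge0.
have qM m : `|q`_m| <= M.
  case: (ltnP m d) => md; last by rewrite nth_default // normr0 ltW.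
  by rewrite /M (bigD1 (Ordinal md)) //= addrCA lerDl addr_ge0 ?sumr_ge0.
have D0 : 0 < d%:R * M + 1 by rewrite ltr_wpDl // mulr_ge0 ?ler0n // ltW.
pose eta := delta * ka / (d%:R * M + 1).
have [K K0K hK] := @late_window R (fun j => `|expansion p q j|) gam eta d K0.+1
  (fun j => normr_ge0 _) hg ltac:(by rewrite divr_gt0 // mulr_gt0).
case: K K0K hK => // K K0K hK.
exists K.+1 => [|z z1]; first exact: ltnW.
set r := ('X^K * p) %% q.
have rcoef l : `|r`_l| <= M * eta.
  rewrite /r (remainder_coef p d K l q0) [X in _ + X]nth_default ?addr0; last first.
    by apply: leq_trans (ltnW (ltn_modpN0 _ q0)) _; rewrite leq_addl.
  apply: le_trans (ler_norm_sum _ _ _) _; apply: le_trans (ler_wpM2l (ltW M0) hK).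
  rewrite mulr_sumr; apply: ler_sum => s _; rewrite normrM mulrC; exact: ler_wpM2r.
have rz : `|(map_poly (real_complex R) r).[z]| <= (delta * ka)%:C.
  rewrite (@horner_coef_wide _ d); last by rewrite size_map_poly ltnW // ltn_modpN0.
  apply: le_trans (ler_norm_sum _ _ _) _.
  apply: (@le_trans _ _ (\sum_(i < d) (M * eta)%:C)).
    apply: ler_sum => i _; rewrite normrM normrX z1 expr1n mulr1 coef_map /=.
    by rewrite norm_real_complex lecR.
  rewrite -rmorph_sum lecR sumr_const card_ord -mulr_natl mulrA /eta mulrA.
  rewrite ler_pdivrMr // [_ * (_ + 1)]mulrC ler_wpM2r ?lerDl //.
  by rewrite mulr_ge0 // ltW.
have zJ := unit_circle_mulJ z1.
have qz0 : qC.[z] != 0.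
  by rewrite -normr_gt0; apply: lt_le_trans (hk z z1); rewrite ltcR.
have sz' : (size (map_poly (real_complex R) p) <= size qC)%N by rewrite !size_map_poly.
have qC0 : qC != 0 by rewrite map_poly_eq0.
have := expansion_eval z K qC0 sz'.
rewrite -(map_polyXn (real_complex R)) -rmorphM /= -map_modp -/r.
move=> ev; set S := \sum_(j < K.+1) _.
have evS : \sum_(i < K.+1) expansion (map_poly (real_complex R) p) qC i * z ^+ (K - i) = z ^+ K * S.
  rewrite mulr_sumr; apply: eq_bigr => i _.
  rewrite expansion_map [RHS]mulrCA; congr (_ * _).
  have iK : (i <= K)%N by rewrite -ltnS.
  have -> : z ^+ K = z ^+ (K - i) * z ^+ i by rewrite -exprD subnK.
  by rewrite -mulrA -exprMn zJ expr1n mulr1.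
rewrite {}evS in ev.
have -> : S - (map_poly (real_complex R) p).[z] / qC.[z] =
    - (z^*%C ^+ K * (map_poly (real_complex R) r).[z] / qC.[z]).
  have : z^*%C ^+ K * (z ^+ K * (map_poly (real_complex R) p).[z]) = 
    z^*%C ^+ K * (qC.[z] * (z ^+ K * S) + (map_poly (real_complex R) r).[z]) by rewrite ev.
  rewrite mulrA -exprMn [_^*%C * z]mulrC zJ expr1n mul1r => ->.
  rewrite mulrDr mulrCA [z^*%C ^+ K * (z ^+ K * S)]mulrA -exprMn [_^*%C * z]mulrC zJ expr1n mul1r.
  by rewrite mulrDl [qC.[z] * S]mulrC mulfK // opprD addrA subrr sub0r.
rewrite normrN normrM normrM normrX normcJ z1 expr1n mul1r normfV.
rewrite ler_pdivrMr ?normr_gt0 //; apply: le_trans rz _.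
by rewrite rmorphM /= ler_wpM2l ?hk // ler0c ltW.
Qed.

End StableExpansion.

(** * Quadratic forms and the matrix inequality *)

Section QuadraticForms.
Context {R : realFieldType}.

Definition qf (d : nat) (S : 'M[R]_d) (x : 'cV[R]_d) : R := (x^T *m S *m x) 0 0.

Lemma qf_addZ (d : nat) (S : 'M[R]_d) (x y : 'cV[R]_d) (a b : R) :
  qf S (a *: x + b *: y) =
  a ^+ 2 * qf S x + b ^+ 2 * qf S y + a * b * (y^T *m (S + S^T) *m x) 0 0.
Proof.
have tr : (x^T *m S *m y) 0 0 = (y^T *m S^T *m x) 0 0.
  by rewrite -[x^T *m S *m y]trmxK [in LHS]mxE !trmx_mul trmxK mulmxA.
have -> : qf S (a *: x + b *: y) =
    (a *: (a *: (x^T *m S *m x)) + a *: (b *: (x^T *m S *m y)) +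
     (b *: (a *: (y^T *m S *m x)) + b *: (b *: (y^T *m S *m y)))) 0 0.
  have e : (a *: x + b *: y)^T = a *: x^T + b *: y^T by rewrite linearD /= !linearZ.
  by rewrite /qf e !mulmxDl !mulmxDr -!scalemxAl -!scalemxAr.
rewrite mulmxDr mulmxDl /qf; move: tr.
move: (x^T *m S *m x) (x^T *m S *m y) (y^T *m S *m x) (y^T *m S *m y) (y^T *m S^T *m x).
by move=> xx xy yx yy yx'; rewrite !mxE => ->; ring.
Qed.

(** Completing the square in all coordinates but the last: a negative definite
    form is bounded by a negative multiple of the square of the last coordinate. *)
Lemma negdef_last (d : nat) (S : 'M[R]_(d + 1)) :
  (forall x : 'cV[R]_(d + 1), x != 0 -> qf S x < 0) ->
  exists2 eps, 0 < eps & forall (x : 'cV[R]_d) u, qf S (col_mx x u%:M) <= - (eps * u ^+ 2).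
Proof.
move=> neg; pose T := S + S^T.
pose T11 := ulsubmx T; pose t := ursubmx T.
have e0 (y : 'cV[R]_d) : y != 0 -> col_mx y (0 : 'cV[R]_1) != 0.
  by apply: contra => /eqP; rewrite -[0 in RHS]col_mx0 => /eq_col_mx[-> _].
have Tq (x : 'cV[R]_(d + 1)) : (x^T *m T *m x) 0 0 = 2 * qf S x.
  have := qf_addZ S x x 1 1; rewrite -/T.
  have -> : 1 *: x + 1 *: x = 2 *: x + 0 *: x by rewrite scale0r addr0 -scalerDl.
  by rewrite qf_addZ -/T !expr1n expr0n /=; lra.
have unitT : T11 \in unitmx.
  rewrite -unitmx_tr unitmxE unitfE; apply/negP => /det0P[v v0].
  rewrite -[v]trmxK -trmx_mul => /(congr1 trmx); rewrite trmxK trmx0 => Tv.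
  have vt0 : v^T != 0 by apply: contra v0 => /eqP v0; rewrite -[v]trmxK v0 trmx0.
  have := neg _ (e0 _ vt0).
  have := Tq (col_mx v^T 0); rewrite -{1}[T]submxK tr_col_mx mul_row_block mul_row_col.
  rewrite trmx0 !mul0mx !addr0 mulmx0 addr0 -mulmxA Tv mulmx0 mxE; lra.
pose y0 := - (invmx T11 *m t).
pose v0 := col_mx y0 (1%:M : 'M[R]_1).
have v00 : v0 != 0.
  apply/negP => /eqP; rewrite -[0 in RHS]col_mx0 => /eq_col_mx[_ /matrixP/(_ 0 0)].
  by rewrite !mxE /= => /eqP; rewrite oner_eq0.
exists (- qf S v0) => [|x u]; first by rewrite oppr_gt0 neg.
have -> : col_mx x u%:M = u *: v0 + 1 *: col_mx (x - u *: y0) 0.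
  by rewrite scale1r scale_col_mx add_col_mx addrC subrK addr0 scalemx1.
rewrite qf_addZ -/T tr_col_mx trmx0 -{1}[T]submxK mul_row_block !mul0mx !addr0.
rewrite mul_row_col mulmx1 -mulmxA -mulmxDr mulmxN mulmxA mulmxV // mul1mx.
rewrite addNr mulmx0 mxE mulr0 addr0 expr1n mul1r mulNr opprK mulrC gerDl.
case: (eqVneq (x - u *: y0) 0) => [->|/e0/neg/ltW //].
by rewrite col_mx0 /qf mulmx0 mxE.
Qed.

End QuadraticForms.

Section LMI.
Context {R : realType}.
Local Notation C := R[i].
Local Open Scope complex_scope.
Variables (np nf nb : nat).
Variables (Ap : 'M[R]_np) (Bp : 'cV[R]_np) (Cp : 'rV[R]_np) (Dp : R).
Variables (m : 'cV[R]_(nf + nb).+1) (X : 'M[R]_(np + maxn nf nb)).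
Notation n := (maxn nf nb).
Notation A := (Atilde Ap Bp nf nb).
Notation B := (@Btilde R np nf nb).
Notation Cr := (Crow Ap Bp Cp Dp nf nb).
Notation Dr := (Drow Ap Bp Cp Dp nf nb).
Notation cpx := (map_mx (real_complex R)).

Lemma lmi_form (x : 'cV[R]_(np + n)) (u : R) :
  qf (lmi_matrix Ap Bp Cp Dp m X) (col_mx x u%:M) =
  qf X (A *m x + u *: B) - qf X x -
  2 * u * \sum_r m r 0 * ((Cr (lag r) *m x) 0 0 + Dr (lag r) * u).
Proof.
pose M := Mf Ap Bp Cp Dp nf nb.
pose xi := col_mx x (u%:M : 'M[R]_1).
pose y : 'cV[R]_(nf + nb).+1 := \col_r ((Cr (lag r) *m x) 0 0 + Dr (lag r) * u).
have My : M *m xi = col_mx y u%:M.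
  rewrite /M /Mf /xi mul_block_col mul0mx add0r mul1mx; congr col_mx.
  apply/matrixP => r j; rewrite !ord1 !mxE; congr (_ + _); last by rewrite big_ord1 !mxE mulr1n.
  by apply: eq_bigr => l _; rewrite !mxE.
have pi_form : (xi^T *m (M^T *m Pi m *m M) *m xi) 0 0 = 2 * u * \sum_r m r 0 * y r 0.
  have -> : xi^T *m (M^T *m Pi m *m M) *m xi = (M *m xi)^T *m Pi m *m (M *m xi).
    by rewrite trmx_mul !mulmxA.
  rewrite My /Pi tr_col_mx mul_row_block !mulmx0 add0r addr0 mul_row_col tr_scalar_mx.
  rewrite mul_scalar_mx mul_mx_scalar -scalemxAl [LHS]mxE [X in X + _]mxE [X in _ + X]mxE.
  have -> : (m^T *m y) 0 0 = \sum_r m r 0 * y r 0.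
    by rewrite mxE; apply: eq_bigr => r _; rewrite mxE.
  have -> : (y^T *m m) 0 0 = \sum_r m r 0 * y r 0.
    by rewrite mxE; apply: eq_bigr => r _; rewrite mxE mulrC.
  ring.
have dyn_form : (xi^T *m block_mx (A^T *m X *m A - X) (A^T *m X *m B)
    (B^T *m X *m A) (B^T *m X *m B) *m xi) 0 0 = qf X (A *m x + u *: B) - qf X x.
  have -> : block_mx (A^T *m X *m A - X) (A^T *m X *m B) (B^T *m X *m A) (B^T *m X *m B) =
    (row_mx A B)^T *m X *m row_mx A B - block_mx X 0 0 (0 : 'M_1).
    rewrite tr_row_mx mul_col_mx mul_col_row opp_block_mx add_block_mx.
    by rewrite !oppr0 !addr0.
  rewrite mulmxBr mulmxBl [LHS]mxE [X in _ + X]mxE; congr (_ - _).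
    have e : row_mx A B *m xi = A *m x + u *: B by rewrite mul_row_col mul_mx_scalar.
    by rewrite /qf -e trmx_mul !mulmxA.
  by rewrite /xi tr_col_mx mul_row_block !mulmx0 !addr0 mul_row_col mul0mx addr0.
rewrite /qf /lmi_matrix mulmxBr mulmxBl [LHS]mxE [X in _ + X]mxE -/M -/xi dyn_form pi_form.
by congr (_ - _ * _); apply: eq_bigr => r _; rewrite mxE.
Qed.

Definition re_mx (a b : nat) (M : 'M[C]_(a, b)) : 'M[R]_(a, b) := map_mx (@complex.Re R) M.
Definition im_mx (a b : nat) (M : 'M[C]_(a, b)) : 'M[R]_(a, b) := map_mx (@complex.Im R) M.

Lemma re_mul (a b c : nat) (M : 'M[R]_(a, b)) (N : 'M[C]_(b, c)) :
  re_mx (cpx M *m N) = M *m re_mx N.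
Proof.
apply/matrixP => i j; rewrite !mxE Re_sum; apply: eq_bigr => l _.
by rewrite !mxE ReZ.
Qed.

Lemma ImD (x y : C) : complex.Im (x + y) = complex.Im x + complex.Im y.
Proof. by case: x => a b; case: y. Qed.

Lemma im_mul (a b c : nat) (M : 'M[R]_(a, b)) (N : 'M[C]_(b, c)) :
  im_mx (cpx M *m N) = M *m im_mx N.
Proof.
apply/matrixP => i j; rewrite !mxE (big_morph _ ImD (erefl _ : complex.Im 0 = 0)).
by apply: eq_bigr => l _; rewrite !mxE; case: (N l j) => u v /=; rewrite mul0r addr0.
Qed.

Lemma re_add (a b : nat) (M N : 'M[C]_(a, b)) : re_mx (M + N) = re_mx M + re_mx N.
Proof. by apply/matrixP => i j; rewrite !mxE ReD. Qed.

Lemma im_add (a b : nat) (M N : 'M[C]_(a, b)) : im_mx (M + N) = im_mx M + im_mx N.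
Proof. by apply/matrixP => i j; rewrite !mxE ImD. Qed.

Lemma re_scale (a b : nat) (z : C) (M : 'M[C]_(a, b)) :
  re_mx (z *: M) = complex.Re z *: re_mx M - complex.Im z *: im_mx M.
Proof. by apply/matrixP => i j; rewrite !mxE; case: z (M i j) => u v []. Qed.

Lemma im_scale (a b : nat) (z : C) (M : 'M[C]_(a, b)) :
  im_mx (z *: M) = complex.Re z *: im_mx M + complex.Im z *: re_mx M.
Proof. by apply/matrixP => i j; rewrite !mxE; case: z (M i j) => u v []. Qed.

Lemma re_cpx (a b : nat) (M : 'M[R]_(a, b)) : re_mx (cpx M) = M.
Proof. by apply/matrixP => i j; rewrite !mxE. Qed.

Lemma im_cpx (a b : nat) (M : 'M[R]_(a, b)) : im_mx (cpx M) = 0.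
Proof. by apply/matrixP => i j; rewrite !mxE. Qed.

Lemma re_im_eq0 (a b : nat) (M : 'M[C]_(a, b)) : re_mx M = 0 -> im_mx M = 0 -> M = 0.
Proof.
move=> /matrixP r0 /matrixP i0; apply/matrixP => i j; have := r0 i j; have := i0 i j.
by rewrite !mxE; case: (M i j) => u v /= -> ->.
Qed.

(** Along a complex exponential trajectory of frequency on the unit circle the
    storage function X returns to its value, so only the supply rate remains. *)
Lemma lmi_on_circle (z : C) (x : 'cV[C]_(np + n)) (u : R) : `|z| = 1 ->
  cpx A *m x + u%:C *: cpx B = z *: x ->
  qf (lmi_matrix Ap Bp Cp Dp m X) (col_mx (re_mx x) u%:M) +
  qf (lmi_matrix Ap Bp Cp Dp m X) (col_mx (im_mx x) 0%:M) =
  - (2 * u * complex.Re (\sum_r (m r 0)%:C *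
       ((cpx (Cr (lag r)) *m x) 0 0 + (Dr (lag r) * u)%:C))).
Proof.
move=> z1 dyn; rewrite !lmi_form scale0r addr0 mulr0 mul0r subr0.
pose c := complex.Re z; pose s := complex.Im z.
have cs : c ^+ 2 + s ^+ 2 = 1.
  by apply: (@complexI R); rewrite add_Re2_Im2 z1 expr1n.
have e1 : A *m re_mx x + u *: B = c *: re_mx x + (- s) *: im_mx x.
  by have := congr1 (@re_mx _ _) dyn; rewrite re_add re_mul !re_scale re_cpx im_cpx /= scale0r
    subr0 scaleNr.
have e2 : A *m im_mx x = c *: im_mx x + s *: re_mx x.
  by have := congr1 (@im_mx _ _) dyn; rewrite im_add im_mul !im_scale re_cpx im_cpx /= scale0r
    scaler0 !addr0.
rewrite e1 e2 !qf_addZ.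
have -> : (im_mx x)^T *m (X + X^T) *m re_mx x = ((re_mx x)^T *m (X + X^T) *m im_mx x)^T.
  have sX : (X + X^T)^T = X + X^T by rewrite linearD /= trmxK addrC.
  by rewrite !trmx_mul trmxK sX mulmxA.
rewrite [_^T 0 0]mxE Re_sum.
have -> : \sum_r complex.Re ((m r 0)%:C *
       ((cpx (Cr (lag r)) *m x) 0 0 + (Dr (lag r) * u)%:C)) =
   \sum_r m r 0 * ((Cr (lag r) *m re_mx x) 0 0 + Dr (lag r) * u).
  apply: eq_bigr => r _; rewrite ReZ ReD -re_mul; congr (_ * (_ + _)).
  by rewrite [RHS]mxE.
move: (\sum_r _) ((re_mx x)^T *m _ *m _) => S N.
have -> : s ^+ 2 = 1 - c ^+ 2 by rewrite -cs; ring.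
rewrite sqrrN; have -> : s ^+ 2 = 1 - c ^+ 2 by rewrite -cs; ring.
ring.
Qed.

End LMI.

(** * Exponential trajectories of the delay-line realization *)

Section Trajectory.
Context {R : realType}.
Local Notation C := R[i].
Local Open Scope complex_scope.
Variables (np nf nb : nat).
Variables (Ap : 'M[R]_np) (Bp : 'cV[R]_np) (Cp : 'rV[R]_np) (Dp : R).
Hypothesis nf0 : (0 < nf)%N.
Notation n := (maxn nf nb).
Notation A := (Atilde Ap Bp nf nb).
Notation B := (@Btilde R np nf nb).
Notation Cb := (Cbar Cp Dp nf nb).
Notation Cr := (Crow Ap Bp Cp Dp nf nb).
Notation Dr := (Drow Ap Bp Cp Dp nf nb).
Notation mk := (markov_par Ap Bp Cp Dp nf nb).
Notation cpx := (map_mx (real_complex R)).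

Let n0 : (0 < n)%N. Proof. by rewrite leq_max nf0. Qed.

(** An impulse needs n steps to travel through the delay line, so it is still
    inside it after j < n steps, j places past its entry point. *)
Lemma impulse_in_delay_line (j : nat) : (j < n)%N ->
  A ^+ j *m B = col_mx 0 (\col_(l < n) (l + j.+1 == n)%N%:R).
Proof.
elim: j => [_|j IH jn].
  rewrite expr0 [1 *m _]mul1mx -[B]vsubmxK; congr col_mx; apply/colP => l; rewrite !mxE /=.
    by have := ltn_ord l; case: eqP => //; lia.
  by congr (nat_of_bool _)%:R; lia.
rewrite exprS -[(_ * _) *m _]mulmxA IH ?(ltnW jn) // mul_block_col !mul0mx !mulmx0 !add0r; congr col_mx.
  apply/colP => i; rewrite !mxE big1 // => l _; rewrite !mxE.
  case: eqP => [->|_]; last by rewrite mul0r.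
  by rewrite add0n (ltn_eqF jn) mulr0.
apply/colP => l; rewrite !mxE.
rewrite (eq_bigr (fun i : 'I_n => (l.+1 == i)%N%:R * (i + j.+1 == n)%N%:R)); last first.
  by move=> i _; rewrite !mxE eq_sym.
rewrite (sum_ord_delta n l.+1 (fun i => (i + j.+1 == n)%N%:R)) addSnnS.
by case: ltnP => ln; rewrite ?mul1r // mul0r; case: eqP => //; lia.
Qed.

Lemma markov_small (j : nat) : (j.+1 < n)%N -> mk j = 0.
Proof.
move=> jn; rewrite /markov_par -mulmxA impulse_in_delay_line ?(ltnW jn) //.
rewrite mul_row_col mulmx0 add0r mxE big1 // => l _; rewrite !mxE.
case: eqP => [->|_]; last by rewrite mul0r.
by rewrite add0n (ltn_eqF jn) mulr0.
Qed.

Variables (z : C) (x : 'cV[C]_(np + n)).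
Hypothesis dyn : cpx A *m x + cpx B = z *: x.
(* the delay line holds the values z^(-j) of the exponential input z^t *)
Hypothesis delay : forall j, (0 < j <= n)%N -> (cpx (@Cdelay R np nf nb j) *m x) 0 0 = z^*%C ^+ j.

Lemma power_on_trajectory (e : nat) :
  cpx (A ^+ e) *m x = z ^+ e *: x - \sum_(l < e) z ^+ l *: cpx (A ^+ (e - l.+1) *m B).
Proof.
elim: e => [|e IH].
  by rewrite big_ord0 subr0 expr0 scale1r (map_mx1 (real_complex R)) mul1mx.
have -> : cpx (A ^+ e.+1) *m x = z *: (cpx (A ^+ e) *m x) - cpx (A ^+ e *m B).
  rewrite exprSr (map_mxM (real_complex R) (A ^+ e) A) -mulmxA.
  have -> : cpx A *m x = z *: x - cpx B by rewrite -dyn addrK.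
  by rewrite mulmxBr -scalemxAr map_mxM.
rewrite IH scalerBr scalerA -exprS -addrA; congr (_ + _).
rewrite big_ord_recl expr0 scale1r subn1 /= opprD addrC; congr (_ - _).
by rewrite scaler_sumr; apply: eq_bigr => l _; rewrite scalerA -exprS.
Qed.

Lemma output_on_trajectory (e : nat) : (cpx (Cb *m A ^+ e) *m x) 0 0 =
  z ^+ e * (cpx Cb *m x) 0 0 - \sum_(l < e) z ^+ l * (mk (e - l.+1))%:C.
Proof.
rewrite map_mxM -mulmxA power_on_trajectory mulmxBr -scalemxAr.
rewrite [LHS]mxE [X in X + _]mxE [X in _ + X]mxE; congr (_ - _).
rewrite mulmx_sumr summxE; apply: eq_bigr => l _.
by rewrite -scalemxAr mxE -map_mxM mxE mulmxA.
Qed.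

Lemma Re_expJ (l : nat) (a : R) :
  complex.Re (a%:C * z^*%C ^+ l) = complex.Re (z ^+ l * a%:C).
Proof. by rewrite ReZ ReZr mulrC -conjcX; case: (z ^+ l). Qed.

(** Row r of C, D undoes the delay of the line and yields the plant output r - nf
    steps back.  For negative lags the
    output also depends on future inputs z^l, which the rows replace by the past
    inputs z^(-l): on the unit circle both have the same real part. *)
Lemma row_on_trajectory (r : 'I_(nf + nb).+1) :
  complex.Re ((cpx (Cr (lag r)) *m x) 0 0 + (Dr (lag r))%:C) =
  complex.Re (z ^+ (n + nf - r) * (cpx Cb *m x) 0 0).
Proof.
have rle : (r <= nf + nb)%N by rewrite -ltnS.
have nfn : (nf <= n)%N by rewrite leq_maxl.
have nbn : (nb <= n)%N by rewrite leq_maxr.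
case: (ltngtP r nf) => rn.
- have -> : lag r = Negz (nf - r).-1.
    by rewrite /lag NegzE prednK ?subn_gt0 // -opprB subzn // ltnW.
  rewrite /Crow /Drow prednK ?subn_gt0 //; set s := (nf - r)%N.
  have -> : (n + nf - r = n + s)%N by rewrite /s; lia.
  have s0 : (0 < s)%N by rewrite subn_gt0.
  have sn : (s <= n)%N by rewrite /s; lia.
  rewrite map_mxD mulmxDl [X in _ (X + _)]mxE output_on_trajectory.
  have -> : (cpx (\sum_(1 <= j < s.+1) mk (n + s - j - 1) *: @Cdelay R np nf nb j) *m x) 0 0 =
      \sum_(1 <= j < s.+1) (mk (n + s - j.+1))%:C * z^*%C ^+ j.
    rewrite raddf_sum mulmx_suml summxE !big_nat; apply: eq_bigr => j /andP[j0 js].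
    rewrite /= map_mxZ -scalemxAl mxE delay; last by rewrite j0 (leq_trans _ sn).
    by congr ((mk _)%:C * _); lia.
  rewrite !ReD ReN !Re_sum.
  rewrite -(big_mkord xpredT (fun l => complex.Re (z ^+ l * (mk (n + s - l.+1))%:C))).
  rewrite big_ltn ?addn_gt0 ?n0 // expr0 mul1r (big_cat_nat (n := s.+1)) //=; last by lia.
  rewrite [X in _ + (_ + X)]big_nat_cond [X in _ + (_ + X)]big1 ?addr0; last first.
    move=> l /andP[/andP[sl ln] _]; rewrite markov_small ?mulr0 //; lia.
  rewrite [X in _ + X + _](eq_bigr (fun l => complex.Re (z ^+ l * (mk (n + s - l.+1))%:C))); last first.
    by move=> l _; rewrite Re_expJ.
  lra.
- have -> : lag r = Posz (r - nf) by rewrite /lag subzn // ltnW.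
  have -> : Dr (Posz (r - nf)) = 0 by move: rn; rewrite -subn_gt0; case: (r - nf)%N.
  rewrite addr0 /Crow.
  have -> : (n - (r - nf) = n + nf - r)%N by lia.
  rewrite output_on_trajectory big1 ?subr0 // => l _.
  by rewrite markov_small ?mulr0 //; have := ltn_ord l; lia.
- have -> : lag r = Posz 0 by rewrite /lag rn subrr.
  rewrite /Crow /Drow subn0 output_on_trajectory rn addnK.
  rewrite -[in \sum_(l < n) _](prednK n0) big_ord_recl expr0 mul1r big1 ?addr0; last first.
    by move=> l _; rewrite markov_small ?mulr0 // lift0; have := ltn_ord l; lia.
  by rewrite [(_ - ord0.+1)%N](_ : _ = (n - 1)%N) ?subrK //= prednK.
Qed.

End Trajectory.

Section FrequencyInequality.
Context {R : realType}.
Local Notation C := R[i].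
Local Open Scope complex_scope.
Variables (np nf nb : nat).
Variables (Ap : 'M[R]_np) (Bp : 'cV[R]_np) (Cp : 'rV[R]_np) (Dp : R).
Hypothesis nf0 : (0 < nf)%N.
Notation n := (maxn nf nb).
Notation A := (Atilde Ap Bp nf nb).
Notation B := (@Btilde R np nf nb).
Notation Cb := (Cbar Cp Dp nf nb).
Notation cpx := (map_mx (real_complex R)).

Let n0 : (0 < n)%N. Proof. by rewrite leq_max nf0. Qed.

Definition resolvent (z : C) : 'M[C]_np := z%:M - cpx Ap.

Definition response (z : C) : C :=
  (cpx Cp *m invmx (resolvent z) *m cpx Bp) 0 0 + Dp%:C.

(** The state at time 0 of the trajectory driven by the exponential input z^t. *)
Definition exp_state (z : C) : 'cV[C]_(np + n) :=
  col_mx (z^*%C ^+ n *: (invmx (resolvent z) *m cpx Bp)) (\col_(l < n) z^*%C ^+ (n - l)).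

Lemma first_entry (a : nat) (M : 'cV[R]_a) (v : 'I_n -> C) (i : 'I_a) :
  \sum_(l < n) (if l == 0%N :> nat then M i 0 else 0)%:C * v l = (M i 0)%:C * v (Ordinal n0).
Proof.
rewrite (bigD1 (Ordinal n0)) //= big1 ?addr0 // => l l0; case: eqP => [e|_]; last by rewrite mul0r.
by case/eqP: l0; apply: val_inj.
Qed.

Lemma exp_state_dyn (z : C) : `|z| = 1 -> resolvent z \in unitmx ->
  cpx A *m exp_state z + cpx B = z *: exp_state z.
Proof.
move=> z1 un; have zJ := unit_circle_mulJ z1.
rewrite /Atilde map_block_mx mul_block_col map_mx0 mul0mx add0r.
have -> : cpx B = col_mx 0 (\col_(l < n) (l.+1 == n)%N%:R).
  rewrite -[B]vsubmxK map_col_mx; congr col_mx; apply/colP => l; rewrite !mxE /=.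
    by have := ltn_ord l; case: eqP => //; lia.
  by rewrite rmorph_nat; congr (nat_of_bool _)%:R; lia.
rewrite add_col_mx scale_col_mx; congr col_mx.
  rewrite addr0 -scalemxAr scalerA mulrC -scalerA.
  have e : cpx Ap = z%:M - resolvent z by rewrite /resolvent subKr.
  rewrite e mulmxBl mul_scalar_mx [resolvent z *m _]mulmxA mulmxV // mul1mx scalerBr -addrA.
  rewrite -[RHS]addr0; congr (_ + _); apply/colP => i; rewrite !mxE.
  rewrite (eq_bigr (fun l : 'I_n => (if l == 0%N :> nat then Bp i 0 else 0)%:C * z^*%C ^+ (n - l))).
    by rewrite (first_entry Bp (fun l => z^*%C ^+ (n - l))) subn0 mulrC addNr.
  by move=> l _; rewrite !mxE.
apply/colP => l; rewrite !mxE.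
case: (ltnP l.+1 n) => ln.
  rewrite (ltn_eqF ln) addr0 (bigD1 (Ordinal ln)) //= !mxE eqxx mul1r big1 ?addr0.
    have -> : (n - l = (n - l.+1).+1)%N by lia.
    by rewrite exprS mulrA zJ mul1r.
  move=> j jl; rewrite !mxE; case: eqP => [e|_]; last by rewrite mul0r.
  by case/eqP: jl; apply: val_inj.
have le : l.+1 == n by rewrite eqn_leq ltn_ord ln.
rewrite le big1 ?add0r; last first.
  move=> j _; rewrite !mxE; case: eqP => [e|_]; last by rewrite mul0r.
  by have := ltn_ord j; rewrite e ltnNge ln.
by rewrite [(n - l)%N](_ : _ = 1%N) ?expr1 ?zJ //; move/eqP: le; lia.
Qed.

Lemma exp_state_delay (z : C) (j : nat) : (0 < j <= n)%N ->
  (cpx (@Cdelay R np nf nb j) *m exp_state z) 0 0 = z^*%C ^+ j.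
Proof.
move=> /andP[j0 jn]; have lt : (n - j < n)%N by lia.
rewrite mxE big_split_ord /= big1 ?add0r; last first.
  move=> i _; rewrite !mxE /=; have := ltn_ord i; case: eqP => [e|_ _]; last by rewrite mul0r.
  by lia.
rewrite (bigD1 (Ordinal lt)) //= big1 ?addr0; last first.
  move=> i il; rewrite !mxE /=; case: eqP => [e|_]; last by rewrite mul0r.
  by case/eqP: il; apply: val_inj => /=; lia.
by rewrite col_mxEd !mxE /= addnBA // eqxx mul1r subKn.
Qed.

Lemma exp_state_output (z : C) :
  (cpx Cb *m exp_state z) 0 0 = z^*%C ^+ n * response z.
Proof.
rewrite /Cbar map_row_mx mul_row_col mxE -scalemxAr mulmxA [X in X + _]mxE mulrDr; congr (_ + _).
rewrite mxE (eq_bigr (fun l : 'I_n => (if l == 0%N :> nat then (Dp%:M : 'M_1) 0 0 else 0)%:C *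
  z^*%C ^+ (n - l))); last by move=> l _; rewrite !mxE mulr1n.
rewrite (first_entry (Dp%:M : 'M_1) (fun l => z^*%C ^+ (n - l))) subn0 mulrC.
by rewrite mxE mulr1n.
Qed.

Variables (m : 'cV[R]_(nf + nb).+1) (X : 'M[R]_(np + n)).
Hypothesis lmi : negdef (lmi_matrix Ap Bp Cp Dp m X).

(** An eigenvector of Ap for an eigenvalue on the unit circle, completed by an empty
    delay line and zero input, would make the negative definite form vanish. *)
Lemma resolvent_unit (z : C) : `|z| = 1 -> resolvent z \in unitmx.
Proof.
move=> z1; rewrite -unitmx_tr unitmxE unitfE; apply/negP => /det0P[v v0].
rewrite -[v]trmxK -trmx_mul => /(congr1 trmx); rewrite trmxK trmx0 => ev.
pose x : 'cV[C]_(np + n) := col_mx v^T 0.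
have dyn : cpx A *m x + (0 : R)%:C *: cpx B = z *: x.
  rewrite scale0r addr0 /Atilde map_block_mx mul_block_col map_mx0 mul0mx !mulmx0 !addr0.
  rewrite scale_col_mx scaler0; congr col_mx; move: ev; rewrite /resolvent mulmxBl.
  by rewrite mul_scalar_mx => /eqP; rewrite subr_eq0 => /eqP.
have := lmi_on_circle Cp Dp m X z1 dyn; rewrite mulr0 mul0r oppr0.
have x0 : x != 0.
  apply: contra v0 => /eqP; rewrite -[0 in RHS]col_mx0 => /eq_col_mx[e _].
  by rewrite -[v]trmxK e trmx0.
have neg (y : 'cV[R]_(np + n)) : y != 0 -> qf (lmi_matrix Ap Bp Cp Dp m X) (col_mx y 0%:M) < 0.
  move=> y0; apply: lmi; apply: contra y0 => /eqP.
  by rewrite -[0 in RHS]col_mx0 => /eq_col_mx[-> _].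
have npos (y : 'cV[R]_(np + n)) : qf (lmi_matrix Ap Bp Cp Dp m X) (col_mx y 0%:M) <= 0.
  case: (eqVneq y 0) => [->|/neg/ltW //]; rewrite (_ : 0%:M = 0) ?col_mx0 /qf ?mulmx0 ?mxE //.
  by apply/matrixP => i j; rewrite !mxE mul0rn.
case: (eqVneq (re_mx x) 0) => [r0|/neg]; last by have := npos (im_mx x); lra.
have : im_mx x != 0.
  by apply: contra x0 => /eqP i0; rewrite (re_im_eq0 r0 i0).
by move=> /neg; have := npos (re_mx x); lra.
Qed.

(** The matrix inequality, evaluated along the exponential trajectory of each
    frequency on the unit circle, makes multiplier times plant strictly positive. *)
Lemma lmi_frequency : exists2 eps, 0 < eps & forall z : C, `|z| = 1 ->
  eps <= complex.Re ((\sum_r (m r 0)%:C * (z ^+ nf * z^*%C ^+ r)) * response z).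
Proof.
have [eps e0 he] := negdef_last lmi; exists (eps / 2) => [|z z1]; first by rewrite divr_gt0.
have un := resolvent_unit z1; have zJ := unit_circle_mulJ z1.
have dyn := exp_state_dyn z1 un.
have dyn1 : cpx A *m exp_state z + (1 : R)%:C *: cpx B = z *: exp_state z.
  by rewrite scale1r.
have := lmi_on_circle Cp Dp m X z1 dyn1.
have := he (re_mx (exp_state z)) 1; have := he (im_mx (exp_state z)) 0.
rewrite expr0n expr1n /= mulr0 mulr1 oppr0 => h1 h2.
have -> : \sum_r (m r 0)%:C * ((cpx (Crow Ap Bp Cp Dp nf nb (lag r)) *m exp_state z) 0 0 +
    (Drow Ap Bp Cp Dp nf nb (lag r) * 1)%:C) =
  \sum_r (m r 0)%:C * ((cpx (Crow Ap Bp Cp Dp nf nb (lag r)) *m exp_state z) 0 0 +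
    (Drow Ap Bp Cp Dp nf nb (lag r))%:C) by apply: eq_bigr => r _; rewrite mulr1.
have -> : complex.Re (\sum_r (m r 0)%:C *
    ((cpx (Crow Ap Bp Cp Dp nf nb (lag r)) *m exp_state z) 0 0 +
    (Drow Ap Bp Cp Dp nf nb (lag r))%:C)) =
  complex.Re ((\sum_r (m r 0)%:C * (z ^+ nf * z^*%C ^+ r)) * response z).
  rewrite mulr_suml !Re_sum; apply: eq_bigr => r _.
  rewrite ReZ (row_on_trajectory Cp Dp nf0 dyn (exp_state_delay z)) exp_state_output.
  rewrite -mulrA ReZ; congr (_ * complex.Re _); rewrite !mulrA; congr (_ * _).
  have rn : (r <= n + nf)%N.
    by have := ltn_ord r; have := leq_maxr nf nb; lia.
  have -> : z ^+ nf = z ^+ (n + nf - r) * z ^+ r * z^*%C ^+ n.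
    by rewrite -exprD subnK // exprD mulrAC -exprMn zJ expr1n mul1r.
  by rewrite [RHS]mulrAC -[_ * z ^+ r * _]mulrA -exprMn zJ expr1n mulr1.
by lra.
Qed.

End FrequencyInequality.

Lemma clear_denominator (F : fieldType) (p q chi k D : F) : q != 0 ->
  (q + k * p) * chi = q * (chi * (1 + k * (p / q) - D) + D * chi).
Proof. by move=> q0; field. Qed.

Lemma adj_form (F : fieldType) (d : nat) (M : 'M[F]_d) (a : 'rV[F]_d) (b : 'cV[F]_d) :
  M \in unitmx -> (a *m \adj M *m b) 0 0 = \det M * (a *m invmx M *m b) 0 0.
Proof.
move=> un; rewrite /invmx un -scalemxAr -scalemxAl [in RHS]mxE mulrA divff ?mul1r //.
by rewrite -unitfE -unitmxE.
Qed.

Section Realization.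
Context {R : realType}.
Local Notation C := R[i].
Local Open Scope complex_scope.
Variable np : nat.
Variables (Ap : 'M[R]_np) (Bp : 'cV[R]_np) (Cp : 'rV[R]_np) (Dp : R).
Notation cpx := (map_mx (real_complex R)).

(** Evaluation of a state-space realization on the unit circle, from the identity
    of rational functions after clearing denominators. *)
Lemma realization_response (p q : {poly R}) (k : R) (z : C) : q != 0 ->
  realizes Ap Bp Cp Dp (1 + tf_const k * (tf_poly p / tf_poly q)) ->
  resolvent Ap z \in unitmx -> (map_poly (real_complex R) q).[z] != 0 ->
  response Ap Bp Cp Dp z = 1 + k%:C * ((map_poly (real_complex R) p).[z] / (map_poly (real_complex R) q).[z]).
Proof.
move=> q0 hP un qz.
pose N := (map_mx polyC Cp *m \adj (char_poly_mx Ap) *m map_mx polyC Bp) 0 0.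
pose chi := char_poly Ap.
have chi0 : tf_poly chi != 0 by rewrite /tf_poly tofrac_eq0 monic_neq0 // char_poly_monic.
have tq0 : tf_poly q != 0 by rewrite /tf_poly tofrac_eq0.
have key : (q + k%:P * p) * chi = q * (N + Dp%:P * chi).
  have tM P Q : tf_poly (P * Q) = tf_poly P * tf_poly Q :> {fraction {poly R}} by exact: tofracM.
  have tD P Q : tf_poly (P + Q) = tf_poly P + tf_poly Q :> {fraction {poly R}} by exact: tofracD.
  apply/eqP; rewrite -tofrac_eq; apply/eqP.
  rewrite -[LHS]/(tf_poly _) -[RHS]/(tf_poly _) !tM !tD !tM.
  rewrite -[tf_poly k%:P]/(tf_const k) -[tf_poly Dp%:P]/(tf_const Dp).
  have -> : tf_poly N = tf_poly chi * (1 + tf_const k * (tf_poly p / tf_poly q) - tf_const Dp).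
    rewrite hP addrK.
    have cm : (tf_z R)%:M - map_mx (@tf_const R) Ap =
        map_mx (@FracField.tofrac {poly R}) (char_poly_mx Ap).
      by rewrite /char_poly_mx map_mxB map_scalar_mx -map_mx_comp.
    have tchi : tf_poly chi = \det ((tf_z R)%:M - map_mx (@tf_const R) Ap).
      by rewrite cm (det_map_mx (@FracField.tofrac {poly R})).
    have un' : (tf_z R)%:M - map_mx (@tf_const R) Ap \in unitmx.
      rewrite unitmxE unitfE -tchi; exact: chi0.
    rewrite tchi -adj_form // cm.
    have e a b (M : 'M[R]_(a, b)) : map_mx (@tf_const R) M =
        map_mx (@FracField.tofrac {poly R}) (map_mx polyC M) by rewrite -map_mx_comp.
    rewrite !e -(map_mx_adj (@FracField.tofrac {poly R})) -!map_mxM.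
    by rewrite [RHS]mxE.
  exact: clear_denominator.
pose ev : {rmorphism {poly R} -> C} := (horner_eval z \o map_poly (real_complex R))%FUN.
have evE P : ev P = (map_poly (real_complex R) P).[z] by [].
have evC (a : R) : ev a%:P = a%:C by rewrite evE map_polyC hornerC.
have evX : ev 'X = z by rewrite evE map_polyX hornerX.
have evcm : map_mx ev (char_poly_mx Ap) = resolvent Ap z.
  apply/matrixP => i j; rewrite !mxE rmorphB rmorphMn /=; congr (_ *+ _ - _).
    exact: evX.
  exact: evC.
have evN : ev N = (cpx Cp *m \adj (resolvent Ap z) *m cpx Bp) 0 0.
  have e a b (M : 'M[R]_(a, b)) : cpx M = map_mx ev (map_mx polyC M).
    by rewrite -map_mx_comp; apply: eq_map_mx => c; rewrite /= -evC.
  by rewrite !e -evcm -map_mx_adj -!map_mxM mxE.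
have evchi : ev chi = \det (resolvent Ap z) by rewrite -evcm det_map_mx.
have det0 : \det (resolvent Ap z) != 0 by rewrite -unitfE -unitmxE.
have evM P Q : ev (P * Q) = ev P * ev Q by exact: rmorphM.
have evD P Q : ev (P + Q) = ev P + ev Q by exact: rmorphD.
have := congr1 ev key; rewrite !evM !evD !evM evN evchi !evC !evE adj_form //.
rewrite /response; move: ((_ *m _) 0 0) => W ek.
by apply: (mulfI det0); apply: (mulfI qz); rewrite mulrDr [\det _ * Dp%:C]mulrC -ek; field.
Qed.

End Realization.

(** * The feedback loop on finite horizons *)

Section FeedbackLoop.
Context {R : realType}.
Implicit Types (f g v w h : nat -> R) (phi : R -> R).

Definition loop_at h phi f g v w (j : nat) : Prop :=
  v j = f j + conv h w j /\ w j = - phi (v j) + g j.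

Lemma slope_mono (k : R) phi : slope_restricted k phi -> {homo phi : a b / a <= b}.
Proof.
move=> sr a b ab; case: (eqVneq b a) => [-> //|ba].
have /andP[+ _] := sr _ _ ba; rewrite pmulr_lge0 ?subr_ge0 // invr_gt0 subr_gt0.
by rewrite lt_neqAle eq_sym ba.
Qed.

Lemma slope_comono (k : R) phi : slope_restricted k phi ->
  {homo (fun x => k * x - phi x) : a b / a <= b}.
Proof.
move=> sr a b ab; case: (eqVneq b a) => [-> //|ba].
have ba0 : 0 < b - a by rewrite subr_gt0 lt_neqAle eq_sym ba.
by have /andP[_] := sr _ _ ba; rewrite ler_pdivrMr //; lra.
Qed.

Lemma slope_bound (k : R) phi x : slope_restricted k phi -> phi 0 = 0 ->
  `|phi x| <= `|k * x|.
Proof.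
move=> sr p0; have hm := slope_mono sr; have hc := slope_comono sr.
case: (leP 0 x) => [|/ltW] x0; have := hm _ _ x0; have := hc _ _ x0;
  rewrite p0 mulr0 subr0 => h1 h2.
  by rewrite !ger0_norm; lra.
by rewrite !ler0_norm; lra.
Qed.

Lemma slope_lipschitz (k : R) phi x y : slope_restricted k phi ->
  `|phi x - phi y| <= k * `|x - y|.
Proof.
move=> sr; wlog yx : x y / y <= x.
  by move=> H; case: (leP y x) => [/H//|/ltW /H]; rewrite [`|phi _ - _|]distrC [`|y - x|]distrC.
have := slope_mono sr yx; have := slope_comono sr yx.
by move=> h1 h2; rewrite !ger0_norm ?subr_ge0 //; lra.
Qed.

Lemma slope_continuous (k : R) phi : slope_restricted k phi -> continuous phi.
Proof.
move=> sr x; apply/cvgrPdist_lt => e e0.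
have K0 : 0 < `|k| + 1 by rewrite ltr_wpDl.
near=> t; apply: le_lt_trans (slope_lipschitz x t sr) _.
have xt : `|x - t| < e / (`|k| + 1).
  by near: t; apply: cvgr_dist_lt; rewrite ?divr_gt0 //; exact: cvg_id.
apply: le_lt_trans (_ : (`|k| + 1) * `|x - t| < _).
  by rewrite ler_wpM2r //; have := ler_norm k; lra.
by rewrite mulrC -ltr_pdivlMr.
Unshelve. all: by end_near. Qed.

(** One time step of the loop can be solved when 1 + k d is positive, d being
    the direct feedthrough: the map to invert is continuous and has all its slopes
    above min 1 (1 + k d). *)
Lemma step_solvable (k d : R) phi : 0 < k -> slope_restricted k phi -> phi 0 = 0 ->
  0 < 1 + k * d -> forall c, exists x, x + d * phi x = c.
Proof.
move=> k0 sr p0 kd c.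
pose S x := x + d * phi x.
pose s := Num.min 1 (1 + k * d).
have s0 : 0 < s by rewrite lt_min ltr01.
have cont : continuous S.
  move=> x; apply: cvgD; first exact: cvg_id.
  by apply: cvgM; [exact: cvg_cst|apply: slope_continuous sr _].
have grow x y : y <= x -> s * (x - y) <= S x - S y.
  move=> yx; have := slope_mono sr yx; have := slope_comono sr yx => h1 h2.
  rewrite /S; have [s1 s2] : s <= 1 /\ s <= 1 + k * d by rewrite /s !ge_min !lexx orbT.
  have xy : 0 <= x - y by rewrite subr_ge0.
  case: (leP 0 d) => d0.
    have : 0 <= d * (phi x - phi y) by rewrite mulr_ge0 ?subr_ge0.
    have : 0 <= (1 - s) * (x - y) by rewrite mulr_ge0 // subr_ge0.
    lra.
  have : 0 <= (- d) * (k * (x - y) - (phi x - phi y)) by rewrite mulr_ge0 //; lra.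
  have : 0 <= (1 + k * d - s) * (x - y) by rewrite mulr_ge0 // subr_ge0.
  lra.
have S0 : S 0 = 0 by rewrite /S p0 mulr0 addr0.
pose b := `|c| / s.
have b0 : 0 <= b by rewrite divr_ge0 // ltW.
have sb : s * b = `|c| by rewrite mulrC divfK // gt_eqF.
have hb : c <= S b by have := grow _ _ b0; rewrite S0 !subr0 sb; have := ler_norm c; lra.
have ha : S (- b) <= c.
  have nb : - b <= 0 by rewrite oppr_le0.
  have := grow _ _ nb; rewrite S0 sub0r opprK sb.
  by have := ler_norm (- c); rewrite normrN; lra.
have [x _ hx] := @IVT R S (- b) b c ltac:(lra) (continuous_subspaceT cont)
  ltac:(by rewrite ge_min le_max ha hb orbT).
by exists x.
Qed.

(** Solving one time step after the other continues a solution beyond a finite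
    horizon; so the inputs may be truncated at the horizon without changing the
    solution before it. *)
Lemma loop_extend h phi f g v w T :
  (forall c, exists x, x + h 0%N * phi x = c) ->
  (forall j, (j < T)%N -> loop_at h phi f g v w j) ->
  exists v' w', (forall j, (j < T)%N -> w' j = w j) /\
    forall j, loop_at h phi f g v' w' j.
Proof.
move=> /choice[sol hsol] hT.
pose V (j : nat) (s : nat -> R) : R :=
  sol (f j + \sum_(i < j) h (j - i)%N * s i + h 0%N * g j).
pose new (j : nat) (s : nat -> R) : R :=
  if (j < T)%N then w j else - phi (V j s) + g j.
(* past n agrees with w' below time n and is zero from n on *)
pose past := fix past (n : nat) : nat -> R :=
  if n is j.+1 then fun i => if i == j then new j (past j) else past j i else fun=> 0.
pose w' j := past j.+1 j.
have pastE n i : (i < n)%N -> past n i = w' i.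
  elim: n => // n IH; rewrite ltnS leq_eqVlt => /orP[/eqP -> //|lt].
  by rewrite /= ltn_eqF // IH.
have w'E j : w' j = new j w'.
  rewrite /w' /= eqxx /new; case: ifP => // _; rewrite /V.
  by congr (- phi (sol (_ + _ + _)) + _); apply: eq_bigr => i _; rewrite pastE.
have w'T j : (j < T)%N -> w' j = w j by move=> jT; rewrite w'E /new jT.
exists (fun j => f j + conv h w' j), w'; split=> // j; split=> //.
case: (ltnP j T) => jT.
  have [e1 e2] := hT j jT; rewrite w'T // e2 e1; congr (- phi (_ + _) + _).
  by apply/esym/eq_conv => i ij; apply: w'T; apply: leq_ltn_trans jT.
have w'j : w' j = - phi (V j w') + g j by rewrite w'E /new ltnNge jT.
rewrite [LHS]w'j; congr (- phi _ + _).
have := hsol (f j + \sum_(i < j) h (j - i)%N * w' i + h 0%N * g j).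
rewrite -/(V j w') conv_recr w'j; lra.
Qed.

End FeedbackLoop.

(** * The homotopy in the loop gain *)

Section Homotopy.
Context {R : realType}.
Implicit Types (f g v w : nat -> R) (phi : R -> R).
Variables (k : R) (h : nat -> R) (gamma eps : R).
Variables (nf L : nat) (m : 'I_L -> R).
Hypothesis k0 : 0 < k.
Hypothesis gamma0 : 0 < gamma.
Hypothesis h_l1 : forall N, \sum_(j < N) `|h j| <= gamma.
Hypothesis eps0 : 0 < eps.
Hypothesis m0 : forall r : 'I_L, r = nf :> nat -> m r = 1.
Hypothesis nfL : (nf < L)%N.
Hypothesis m_small : \sum_(r | r != Ordinal nfL) `|m r| < 1.

Definition plant w (j : nat) : R := w j + k * conv h w j.

Hypothesis plant_pos : forall T w, (forall i, (T <= i)%N -> w i = 0) ->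
  eps * sqn T w <= zform nf m (T + nf) w (plant w).

Let mass0 : 0 < mass m.
Proof. by rewrite (mass_split m0 nfL) ltr_pwDl // sumr_ge0. Qed.

Lemma plant_bound T w : sqn T (plant w) <= (2 + 2 * (k * gamma) ^+ 2) * sqn T w.
Proof.
have := sqnD T w (fun j => k * conv h w j); rewrite sqnZ.
have : 0 <= k ^+ 2 * (gamma ^+ 2 * sqn T w - sqn T (conv h w)).
  by rewrite mulr_ge0 ?sqr_ge0 // subr_ge0 conv_bound.
rewrite -/(plant w); lra.
Qed.

Lemma corr_extend T r (u y : nat -> R) : corr nf (T + nf) r (fun a => if (a < T)%N then u a else 0)
  (fun b => if (b < T)%N then y b else 0) = corr nf T r u y.
Proof.
rewrite /corr -(sum_ord_trunc T nf (fun a => \sum_(b < T) (a + nf == b + r)%N%:R * u a * y b)).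
apply: eq_bigr => a _; case: ifP => _; last by rewrite big1 // => b _; rewrite mulr0 mul0r.
rewrite -(sum_ord_trunc T nf (fun b => (a + nf == b + r)%N%:R * u a * y b)).
by apply: eq_bigr => b _; case: ifP => // _; rewrite mulr0.
Qed.

(** Truncating the multiplier form at T loses only the terms that pair w on a
    window of nf times before T with the output of the plant after T; for a square
    summable w there are arbitrarily late T that make this loss small. *)
Lemma plant_pos_l2 w Q eta T0 : (forall T, sqn T w <= Q) -> 0 < eta ->
  exists2 T, (T0 <= T)%N & eps * sqn T w - eta <= zform nf m T w (plant w).
Proof.
move=> wQ eta0; set Gam := 2 + 2 * (k * gamma) ^+ 2.
have Gam0 : 0 < Gam by rewrite ltr_pwDl // mulr_ge0 ?sqr_ge0.
have Q0 : 0 <= Q := le_trans (sqn_ge0 0 w) (wQ 0%N).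
have MG0 : 0 < mass m * Gam * (Q + 1) by rewrite !mulr_gt0 //; lra.
pose K := mass m * Gam * (Q + 1) / eta.
have K0 : 0 < K by rewrite divr_gt0.
have [T1 T01 hT1] := @late_window R (fun a => w a ^+ 2) Q (eta / (mass m * K)) nf T0
  (fun a => sqr_ge0 _) wQ ltac:(by rewrite divr_gt0 // mulr_gt0).
exists (T1 + nf)%N; first by apply: leq_trans T01 (leq_addr _ _).
set T := (T1 + nf)%N.
pose wT a := if (a < T)%N then w a else 0.
pose wW a := if (T1 <= a < T)%N then w a else 0.
pose yO b := if (b < T)%N then 0 else plant wT b.
have wTE a : (a < T)%N -> wT a = w a by rewrite /wT => ->.
have split : zform nf m (T + nf) wT (plant wT) =
    zform nf m T w (plant w) + zform nf m (T + nf) wW yO.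
  rewrite /zform -big_split; apply: eq_bigr => r _ /=; rewrite -mulrDr; congr (_ * _).
  transitivity (corr nf T r w (plant wT) + corr nf (T + nf) r wW yO); last first.
    congr (_ + _); apply: eq_bigr => a _; apply: eq_bigr => b _; congr (_ * _).
    rewrite /plant wTE //; congr (_ + _ * _); apply: eq_conv => i ib.
    by apply: wTE; apply: leq_ltn_trans ib _.
  rewrite -(corr_extend T r w (plant wT)) /corr -big_split; apply: eq_bigr => a _ /=.
  rewrite -big_split; apply: eq_bigr => b _ /=.
  rewrite /yO; case: (ltnP b T) => bT; first by rewrite mulr0 addr0.
  rewrite mulr0 add0r; congr (_ * _).
  case: eqP => [e|_]; last by rewrite !mul0r.
  by rewrite !mul1r /wT /wW; have -> : (T1 <= a)%N by lia.
have wTsq : sqn (T + nf) wT = sqn T w.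
  by rewrite -[RHS](sum_ord_trunc T nf (fun a => w a ^+ 2)); apply: eq_bigr => a _; rewrite /wT; case: ifP; rewrite ?expr0n.
have wWsq : sqn (T + nf) wW <= eta / (mass m * K).
  apply: le_trans hT1.
  rewrite /sqn -(big_mkord xpredT (fun a => wW a ^+ 2)) (big_cat_nat (n := T1)) //=; last by lia.
  rewrite big_nat_cond big1 ?add0r; last first.
    by move=> a /andP[/andP[_ lt] _]; rewrite /wW leqNgt lt expr0n.
  rewrite (big_cat_nat (n := T)) //= ?leq_addr //.
  rewrite [X in _ + X]big_nat_cond [X in _ + X]big1 ?addr0; last first.
    by move=> a /andP[/andP[le _] _]; rewrite /wW ltnNge le andbF expr0n.
  rewrite -{1}[T1]add0n big_addn addKn big_mkord; apply: ler_sum => s _.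
  by rewrite /wW addnC; case: ifP => // _; rewrite expr0n sqr_ge0.
have yOsq : sqn (T + nf) yO <= Gam * Q.
  apply: (@le_trans _ _ (sqn (T + nf) (plant wT))).
    by apply: le_sqn2 => b _; rewrite /yO; case: ifP; rewrite ?normr0.
  by apply: le_trans (plant_bound _ _) _; rewrite ler_pM2l // wTsq.
have := @plant_pos T wT ltac:(by move=> i Ti; rewrite /wT ltnNge Ti).
have -> : sqn T wT = sqn T w by apply: eq_sqn.
rewrite split.
have := zform_bound nf m (T + nf) wW yO K0.
have b1 : mass m * (K * sqn (T + nf) wW) <= eta.
  by rewrite mulrA mulrC -ler_pdivlMr // mulr_gt0.
have b2 : mass m * (K^-1 * sqn (T + nf) yO) <= eta.
  rewrite mulrCA mulrC ler_pdivrMr // /K [eta * _]mulrC divfK ?gt_eqF // -mulrA.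
  rewrite ler_pM2l //; apply: le_trans yOsq _; rewrite ler_pM2l //; lra.
rewrite mulrDr; have := ler_norm (zform nf m (T + nf) wW yO); lra.
Qed.

Definition multiplier_passive phi : Prop :=
  forall T v, 0 <= zform nf m T (phi \o v) ((fun x => k * x - phi x) \o v).

Definition scaled (tau : R) (j : nat) : R := tau * h j.

Lemma conv_scaled tau w j : conv (scaled tau) w j = tau * conv h w j.
Proof. by rewrite /conv mulr_sumr; apply: eq_bigr => i _; rewrite mulrA. Qed.

(** A bound for square summable solutions that is uniform along the homotopy:
    the plant 1 + k tau G is a convex combination of 1 and 1 + k G, both strictly
    positive with respect to the multiplier. *)
Lemma apriori : exists2 C, 0 < C & forall tau phi f g v w F Q,
  0 <= tau <= 1 -> multiplier_passive phi ->
  (forall j, loop_at (scaled tau) phi f g v w j) ->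
  (forall T, sqn T w <= Q) -> (forall T, sqn T f + sqn T g <= F) ->
  forall T, sqn T w <= C * F.
Proof.
set Gam := 2 + 2 * (k * gamma) ^+ 2.
have Gam0 : 0 < Gam by rewrite ltr_pwDl // mulr_ge0 ?sqr_ge0.
set e0 := 1 - \sum_(r | r != Ordinal nfL) `|m r|.
have e00 : 0 < e0 by rewrite subr_gt0.
pose e1 := Num.min e0 eps.
have e10 : 0 < e1 by rewrite lt_min e00.
pose K := mass m * (Gam + 1) / e1.
have K0 : 0 < K by rewrite divr_gt0 // mulr_gt0 // addr_gt0.
pose C1 := mass m * (K + 1) * (2 * k ^+ 2 + 3).
have C10 : 0 < C1.
  by rewrite /C1 !mulr_gt0 //; have := sqr_ge0 k; lra.
exists (C1 / e1); first by rewrite divr_gt0.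
move=> tau phi f g v w F Q /andP[t0 t1] mp lp wQ fgF T0.
have F0 : 0 <= F by apply: le_trans (fgF 0%N); rewrite addr_ge0 ?sqn_ge0.
suff key eta : 0 < eta -> sqn T0 w <= C1 / e1 * F + eta.
  by rewrite leNgt; apply/negP => lt; have := key ((sqn T0 w - C1 / e1 * F) / 2); lra.
move=> eta0.
have [T T0T hT] := plant_pos_l2 T0 wQ (divr_gt0 (mulr_gt0 eta0 e10) (ltr0Sn R 1)).
apply: le_trans (le_sqn w T0T) _.
pose e j := k * f j - g j.
have esq : sqn T e <= 2 * k ^+ 2 * sqn T f + 2 * sqn T g.
  have := sqnD T (fun j => k * f j) (fun j => -1 * g j); rewrite !sqnZ sqrrN expr1n mul1r mulrA.
  by congr (_ <= _); apply: eq_sqn => j _; rewrite /e mulN1r.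
have gram : 0 <= zform nf m T (fun a => -1 * w a + g a)
    (fun a => tau * plant w a + ((1 - tau) * w a + e a)).
  have := mp T v; congr (_ <= _); apply: eq_zform => a _ /=; have [e2 e3] := lp a.
    by rewrite e3; ring.
  have -> : phi (v a) = g a - w a by rewrite e3; ring.
  by rewrite e2 conv_scaled /plant /e; ring.
have wsq := sqn_ge0 T w.
have := zform_coercive m0 nfL T w; rewrite -/e0.
clearbody e; move: gram; rewrite zform_lin1 !zform_lin2.
have KV0 : 0 < K^-1 by rewrite invr_gt0.
have := zform_bound nf m T g (plant w) K0.
have := zform_bound nf m T g w K0.
have := zform_bound nf m T g e ltr01; rewrite invr1 !mul1r.
have := zform_bound nf m T w e KV0; rewrite invrK.
have := ler_norm (zform nf m T g (plant w)).
have := ler_norm (zform nf m T g w).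
have := ler_norm (zform nf m T g e).
have := ler_norm (- zform nf m T w e); rewrite normrN.
have := plant_bound T w; rewrite -/Gam.
move: (zform nf m T w w) (zform nf m T g e) (zform nf m T w e) (zform nf m T g w)
  (zform nf m T w (plant w)) (zform nf m T g (plant w)) hT
  => Zww Zge Zwe Zgw Zwp Zgp hT pb n1 n2 n3 n4 b1 b2 b3 b4 gram coer.
have fg := fgF T; have fsq := sqn_ge0 T f; have gsq := sqn_ge0 T g.
move: (sqn T (plant w)) (sqn T f) (sqn T g) (sqn T e) (sqn T w) pb esq b1 b2 b3 b4 fg fsq gsq wsq coer hT
  => sp sf sg se sw pb esq b1 b2 b3 b4 fg fsq gsq wsq coer hT.
have e1e0 : e1 * sw <= e0 * sw by rewrite ler_wpM2r // /e1 ge_min lexx.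
have e1eps : e1 * sw <= eps * sw by rewrite ler_wpM2r // /e1 ge_min lexx orbT.
have low : e1 * sw - eta * e1 / 2 <= tau * Zwp + (1 - tau) * Zww.
  have ee : 0 <= eta * e1 / 2 by rewrite !mulr_ge0 ?invr_ge0 ?ltW.
  have : 0 <= tau * (Zwp - (e1 * sw - eta * e1 / 2)) by rewrite mulr_ge0 // subr_ge0; lra.
  have : 0 <= (1 - tau) * (Zww - (e1 * sw - eta * e1 / 2)) by rewrite mulr_ge0 ?subr_ge0 //; lra.
  lra.
(* the weight K is tuned so that the w-parts of the bounds absorb only half of e1 *)
have Kw : mass m * (K^-1 * ((Gam + 1) * sw)) = e1 * sw.
  have [n1' n2' n3'] : [/\ mass m != 0, Gam + 1 != 0 & e1 != 0].
    by split; apply: lt0r_neq0 => //; rewrite addr_gt0.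
  by rewrite /K; field; rewrite ?n1' ?n2' ?n3'.
have Gam1 : 1 <= Gam by rewrite /Gam; have := sqr_ge0 (k * gamma); lra.
have mK : 0 < mass m * K^-1 by rewrite mulr_gt0.
clearbody K Gam e1 e0.
move: (K^-1) KV0 Kw mK b1 b3 b4 => KV KV0 Kw mK b1 b3 b4.
have up1 : 2 * Zgp <= mass m * (K * sg + KV * (Gam * sw)).
  have : 0 <= mass m * KV * (Gam * sw - sp) by rewrite mulr_ge0 ?subr_ge0 // ltW.
  lra.
have up2 : 2 * Zgw <= mass m * (K * sg + KV * (Gam * sw)).
  have : 0 <= mass m * KV * ((Gam - 1) * sw) by rewrite !mulr_ge0 ?subr_ge0 // ltW.
  lra.
have up : 2 * (tau * Zgp + (1 - tau) * Zgw) <= mass m * (K * sg + KV * (Gam * sw)).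
  set B := mass m * _ in up1 up2 *.
  have : 0 <= tau * (B - 2 * Zgp) by rewrite mulr_ge0 // subr_ge0.
  have : 0 <= (1 - tau) * (B - 2 * Zgw) by rewrite mulr_ge0 // subr_ge0.
  lra.
have sum0 : 2 * (e1 * sw) <= eta * e1 + mass m * (K * sg + KV * (Gam * sw)) +
    mass m * (sg + se) + mass m * (KV * sw + K * se) by lra.
have sum1 : e1 * sw <= eta * e1 + mass m * (K + 1) * (sg + se) by lra.
have sum2 : mass m * (K + 1) * (sg + se) <= C1 * F.
  rewrite /C1 -[leRHS]mulrA ler_pM2l ?mulr_gt0 ?addr_gt0 //.
  have : 0 <= (2 * k ^+ 2 + 3) * (F - (sf + sg)).
    by rewrite mulr_ge0 ?subr_ge0 // addr_ge0 // mulr_ge0 // sqr_ge0.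
  by have : 0 <= k ^+ 2 * sg; [rewrite mulr_ge0 ?sqr_ge0|lra].
rewrite -(ler_pM2l e10) mulrDr mulrA [e1 * (C1 / e1)]mulrC divfK ?gt_eqF //; lra.
Qed.

(** The nonlinearity is not fixed, so that the linear loop can serve as a test of
    solvability for all the others. *)
Definition stable_at (tau : R) : Prop :=
  0 < 1 + k * (tau * h 0%N) /\
  forall phi f g v w F, slope_restricted k phi -> phi 0 = 0 -> multiplier_passive phi ->
    (forall T, sqn T f + sqn T g <= F) ->
    (forall j, loop_at (scaled tau) phi f g v w j) ->
    exists Q, forall T, sqn T w <= Q.

Lemma linear_passive : multiplier_passive (fun x => k * x).
Proof.
move=> T v; rewrite zformE big1 // => a _; rewrite [X in _ * X]big1 ?mulr0 // => r _.
by rewrite big1 ?mulr0 // => b _; rewrite /= subrr mulr0.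
Qed.

Lemma stable_at0 : stable_at 0.
Proof.
split=> [|phi f g v w F sr p0 _ hF lp]; first by rewrite mul0r mulr0 addr0.
exists (2 * (k ^+ 2 * F) + 2 * F) => T.
have -> : sqn T w = sqn T (fun j => - phi (f j) + g j).
  by apply: eq_sqn => j _; have [e1 e2] := lp j; rewrite e2 e1 conv_scaled mul0r addr0.
apply: le_trans (sqnD _ _ _) _.
have : sqn T (fun a => - phi (f a)) <= k ^+ 2 * sqn T f.
  by rewrite -sqnZ; apply: le_sqn2 => a _; rewrite normrN; apply: slope_bound.
have := hF T; have := sqn_ge0 T f; have := sqn_ge0 T g => h1 h2 h3 h4.
have : 0 <= k ^+ 2 * (F - sqn T f) by rewrite mulr_ge0 ?sqr_ge0 //; lra.
lra.
Qed.

(** A small step of the homotopy, by the small gain theorem: the change of the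
    gain is treated as a disturbance, on a truncated horizon.  The uniform bound,
    applied to the linear loop phi x = k x driven by a unit impulse, also keeps
    1 + k tau h 0 away from zero, so that solvability of the loop persists.  The
    factor 4 in the step size leaves half of the square sum of w to be absorbed. *)
Lemma stable_at_step C tau tau' :
  (forall tau phi f g v w F Q,
    0 <= tau <= 1 -> multiplier_passive phi ->
    (forall j, loop_at (scaled tau) phi f g v w j) ->
    (forall T, sqn T w <= Q) -> (forall T, sqn T f + sqn T g <= F) ->
    forall T, sqn T w <= C * F) ->
  0 < C -> 0 <= tau <= 1 -> 4 * C * ((tau' - tau) * gamma) ^+ 2 <= 1 ->
  stable_at tau -> stable_at tau'.
Proof.
move=> hC C0 t01 hstep [th0 st].
set D := tau' - tau in hstep.
have h0g : `|h 0%N| <= gamma by have := h_l1 1; rewrite big_ord1.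
have solv phi : slope_restricted k phi -> phi 0 = 0 ->
    forall c, exists x, x + scaled tau 0 * phi x = c.
  by move=> sr p0; apply: step_solvable sr p0 th0.
have lin_sr : slope_restricted k (fun x => k * x).
  by move=> x1 x2 x12; rewrite -mulrBr mulfK ?subr_eq0 // lexx ltW.
split.
  pose f (j : nat) : R := (j == 0)%N%:R; pose g (j : nat) : R := 0.
  have fgF T : sqn T f + sqn T g <= 1.
    rewrite /sqn [X in _ + X]big1 ?addr0; last by move=> a _; rewrite expr0n.
    rewrite (eq_bigr (fun a : 'I_T => (0 == a)%N%:R * (fun=> 1) a)); last first.
      by move=> [[|a] aT] _; rewrite /f /= ?expr1n ?expr0n ?mul1r ?mul0r.
    by rewrite (sum_ord_delta T 0 (fun=> 1)) mulr1 lern1; case: (_ < _)%N.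
  have [v [w [_ lp]]] := @loop_extend _ (scaled tau) (fun x => k * x) f g g g 0
    (solv _ lin_sr (mulr0 k)) ltac:(by []).
  have [Q wQ] := st _ f g v w 1 lin_sr (mulr0 k) linear_passive fgF lp.
  have := hC _ _ _ _ _ _ _ _ t01 linear_passive lp wQ fgF 1%N.
  rewrite /sqn big_ord1 mulr1 /=; have [] := lp 0%N.
  rewrite /conv big_ord1 subnn /f eqxx /g addr0 => -> e wC.
  have kC : k ^+ 2 <= C * (1 + k * (tau * h 0%N)) ^+ 2.
    have -> : k ^+ 2 = (1 + k * (tau * h 0%N)) ^+ 2 * w 0%N ^+ 2.
      rewrite -exprMn; have -> : (1 + k * (tau * h 0%N)) * w 0%N = - k; last by rewrite sqrrN.
      by rewrite mulrDl mul1r {1}e /scaled /=; ring.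
    by rewrite mulrC ler_wpM2r ?sqr_ge0.
  set th := 1 + _ in th0 kC.
  have -> : 1 + k * (tau' * h 0%N) = th + k * D * h 0%N by rewrite /th /D; ring.
  have d1 : 4 * (k * D * h 0%N) ^+ 2 <= th ^+ 2.
    rewrite -(ler_pM2l C0).
    have : (h 0%N) ^+ 2 <= gamma ^+ 2.
      by rewrite -[h 0%N ^+ 2]real_normK ?num_real // lerXn2r ?nnegrE ?(ltW gamma0).
    have : 0 <= k ^+ 2 * (1 - 4 * C * (D * gamma) ^+ 2) by rewrite mulr_ge0 ?sqr_ge0 ?subr_ge0.
    move=> p1 hg.
    have : 0 <= 4 * C * (k * D) ^+ 2 * (gamma ^+ 2 - h 0%N ^+ 2).
      by rewrite mulr_ge0 ?subr_ge0 // mulr_ge0 ?sqr_ge0 // mulr_ge0 // ltW.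
    lra.
  have : `|2 * (k * D * h 0%N)| <= th.
    rewrite -ler_sqr ?nnegrE ?(ltW th0) // real_normK ?num_real // exprMn; lra.
  rewrite ler_norml; lra.
move=> phi f g v w F sr p0 mp fgF lp.
exists (4 * C * F) => T.
pose trunc (x : nat -> R) j := if (j < T)%N then x j else 0.
have sqn_trunc x N : sqn N (trunc x) <= sqn T x.
  apply: (@le_trans _ _ (sqn (T + N) (trunc x))); first by apply: le_sqn; rewrite leq_addl.
  rewrite -[leRHS](sum_ord_trunc T N (fun a => x a ^+ 2)); apply: ler_sum => a _.
  by rewrite /trunc; case: ifP; rewrite ?expr0n.
pose f' j := f j + D * conv h w j.
have [v' [w' [w'T lp']]] := @loop_extend _ (scaled tau) phi (trunc f') (trunc g) v w T
  (solv _ sr p0) ltac:(move=> j jT; have [e1 e2] := lp j; split;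
    [rewrite e1 /trunc jT /f' !conv_scaled /D; ring | by rewrite /trunc jT]).
pose F' := sqn T f' + sqn T g.
have F'b N : sqn N (trunc f') + sqn N (trunc g) <= F' by apply: lerD; apply: sqn_trunc.
have [Q wQ] := st _ _ _ _ _ F' sr p0 mp F'b lp'.
have := hC _ _ _ _ _ _ _ _ t01 mp lp' wQ F'b T.
have -> : sqn T w' = sqn T w by apply: eq_sqn.
have f'b : sqn T f' <= 2 * sqn T f + 2 * ((D * gamma) ^+ 2 * sqn T w).
  apply: le_trans (sqnD _ _ _) _; rewrite lerD2l ler_pM2l // sqnZ exprMn -[leRHS]mulrA.
  by rewrite ler_wpM2l ?sqr_ge0 // conv_bound.
have := fgF T; have := sqn_ge0 T w; have := sqn_ge0 T g; rewrite /F' => g0 w0 fgT.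
have : 0 <= C * (2 * sqn T f + 2 * ((D * gamma) ^+ 2 * sqn T w) - sqn T f').
  by rewrite mulr_ge0 ?subr_ge0 // ltW.
have : 0 <= C * (F - (sqn T f + sqn T g)) by rewrite mulr_ge0 ?subr_ge0 // ltW.
have : 0 <= C * sqn T g by rewrite mulr_ge0 // ltW.
have : 0 <= (1 - 4 * C * (D * gamma) ^+ 2) * sqn T w by rewrite mulr_ge0 // subr_ge0.
lra.
Qed.

Lemma stable_at1 : stable_at 1.
Proof.
have [C C0 hC] := apriori.
(* N steps of length 1 / N are short enough for the step lemma *)
pose N := (Num.bound (4 * C * gamma ^+ 2)).+1.
have N1 : 4 * C * gamma ^+ 2 <= N%:R ^+ 2.
  apply: (@le_trans _ _ N%:R); last by rewrite expr2 ler_peMl ?ler0n ?ler1n.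
  apply: ltW; apply: lt_trans (archi_boundP _) _; last by rewrite ltr_nat.
  by rewrite !mulr_ge0 ?sqr_ge0 ?ltW.
have Nn : (N%:R : R) != 0 by rewrite pnatr_eq0.
have H i : (i <= N)%N -> stable_at (i%:R / N%:R).
  elim: i => [_|i IH iN]; first by rewrite mul0r; exact: stable_at0.
  apply: (stable_at_step hC C0) (IH (ltnW iN)).
    rewrite divr_ge0 //= ler_pdivrMr ?ltr0n // mul1r ler_nat; exact: ltnW.
  have -> : i.+1%:R / N%:R - i%:R / N%:R = N%:R^-1 :> R.
    by rewrite -mulrBl -addn1 natrD addrAC subrr add0r mul1r.
  rewrite exprMn exprVn mulrCA mulrC.
  by rewrite ler_pdivrMr ?mul1r // exprn_gt0 // ltr0n.
by have := H N (leqnn N); rewrite divff.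
Qed.

End Homotopy.

(** * The stability theorem *)

Lemma in_l2P (R : realType) (x : nat -> R) :
  in_l2 x <-> exists Q, forall T, sqn T x <= Q.
Proof.
have se T : series (fun j => x j ^+ 2) T = sqn T x by rewrite /series /= big_mkord.
have nd : nondecreasing_seq (series (fun j => x j ^+ 2)).
  by move=> a b ab; rewrite !se; apply: le_sqn.
split=> [cv|[Q hQ]].
  exists (limn (series (fun j => x j ^+ 2))) => T; rewrite -se.
  exact: nondecreasing_cvgn_le.
by apply: nondecreasing_is_cvgn => //; exists Q => _ [T _ <-]; rewrite se.
Qed.

Lemma lti_expansion (R : realType) (p q : {poly R}) (w : nat -> R) (j : nat) :
  q != 0 -> lti (tf_poly p / tf_poly q) w j = conv (expansion p q) w j.
Proof. by move=> q0; apply: eq_bigr => i _; rewrite impulse_frac. Qed.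

Lemma conv_plant (R : realType) (k : R) (h w : nat -> R) (j : nat) :
  conv (fun i => (i == 0)%N%:R + k * h i) w j = plant k h w j.
Proof.
rewrite /plant /conv (eq_bigr (fun i : 'I_j.+1 =>
  (j == i)%N%:R * w i + k * (h (j - i)%N * w i))); last first.
  move=> i _; rewrite mulrDl mulrA; congr ((nat_of_bool _)%:R * _ + _).
  by have := ltn_ord i; lia.
by rewrite big_split -mulr_sumr /= (sum_ord_delta j.+1 j w) ltnSn mul1r.
Qed.

Section Stability.
Context {R : realType}.
Local Open Scope complex_scope.
Variables (k : R) (p q : {poly R}) (np nf nb : nat).
Variables (Ap : 'M[R]_np) (Bp : 'cV[R]_np) (Cp : 'rV[R]_np) (Dp : R).
Variables (m : 'cV[R]_(nf + nb).+1) (X : 'M[R]_(np + maxn nf nb)).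
Hypothesis k0 : 0 < k.
Hypothesis nf0 : (0 < nf)%N.
Hypothesis hm0 : forall r : 'I_(nf + nb).+1, lag r = 0 -> m r 0 = 1.

Let mf (r : 'I_(nf + nb).+1) := m r 0.

Lemma center_lt : (nf < (nf + nb).+1)%N.
Proof. by rewrite ltnS leq_addr. Qed.

Let r0 := Ordinal center_lt.

Lemma lag_eq0 (r : 'I_(nf + nb).+1) : (lag r == 0) = (r == r0).
Proof. by rewrite /lag subr_eq0 eqz_nat. Qed.

Lemma center_coef (r : 'I_(nf + nb).+1) : r = nf :> nat -> mf r = 1.
Proof. by move=> e; apply: hm0; apply/eqP; rewrite lag_eq0; apply/eqP/val_inj. Qed.

(** Both sign conditions make the center coefficient dominate the sum of the moduli
    of all the others. *)
Lemma multiplier_dominant :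
  ((forall r : 'I_(nf + nb).+1, lag r != 0 -> m r 0 <= 0) /\
     0 < \sum_(r < (nf + nb).+1) m r 0) \/
  (exists mp mm : 'cV[R]_(nf + nb).+1,
     m = mp - mm /\
     (forall r : 'I_(nf + nb).+1, lag r = 0 -> mp r 0 = 1 /\ mm r 0 = 0) /\
     (forall r : 'I_(nf + nb).+1, 0 <= mp r 0 /\ 0 <= mm r 0) /\
     \sum_(r < (nf + nb).+1) mp r 0 + \sum_(r < (nf + nb).+1) mm r 0 < 2) ->
  \sum_(r | r != r0) `|mf r| < 1.
Proof.
case=> [[mneg]|[mp [mm [mE [mpm0 [mpm_ge0]]]]]].
  have -> : \sum_(r | r != r0) `|mf r| = - \sum_(r | r != r0) m r 0.
    by rewrite -sumrN; apply: eq_bigr => r rr; rewrite ler0_norm // mneg // lag_eq0.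
  by rewrite (bigD1 r0) //= -/(mf r0) center_coef //; lra.
rewrite (bigD1 r0) //= [X in _ + X < _](bigD1 r0) //=.
have [-> ->] := mpm0 r0 ltac:(by apply/eqP; rewrite lag_eq0).
have : \sum_(r | r != r0) `|mf r| <=
    \sum_(r | r != r0) mp r 0 + \sum_(r | r != r0) mm r 0.
  rewrite -big_split; apply: ler_sum => r _ /=; have [p0 n0] := mpm_ge0 r.
  by rewrite /mf mE !mxE (le_trans (ler_normB _ _)) // !ger0_norm.
lra.
Qed.

Hypothesis q0 : q != 0.
Hypothesis q_stable : forall z : R[i], root (map_poly (real_complex R) q) z -> `|z| < 1.
Hypothesis proper : (size p <= size q)%N.
Hypothesis hP : realizes Ap Bp Cp Dp (1 + tf_const k * (tf_poly p / tf_poly q)).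
Hypothesis lmi : negdef (lmi_matrix Ap Bp Cp Dp m X).

(** Half of the strict margin on the circle pays for truncating the impulse response
    of G, which is what makes the frequency response a trigonometric polynomial. *)
Lemma plant_positive : exists2 eps, 0 < eps & forall T w,
  (forall i, (T <= i)%N -> w i = 0) ->
  eps * sqn T w <= zform nf mf (T + nf) w (plant k (expansion p q) w).
Proof.
have [eps e0 freq] := lmi_frequency nf0 lmi.
have mu0 : 0 < mass mf by rewrite (mass_split center_coef center_lt) ltr_pwDl // sumr_ge0.
exists (eps / 2) => [|T w w0]; first by rewrite divr_gt0.
pose P j := (j == 0)%N%:R + k * expansion p q j.
have -> : zform nf mf (T + nf) w (plant k (expansion p q) w) =
    zform nf mf (T + nf) w (conv P w).
  by apply: eq_zform => // a _; rewrite conv_plant.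
apply: positive_on_signals => //.
pose delta := eps / (2 * k * mass mf).
have delta0 : 0 < delta by rewrite divr_gt0 // !mulr_gt0.
have deltaE : mass mf * (k * delta) = eps / 2 by rewrite /delta; field; rewrite !gt_eqF.
clearbody delta.
have [K TK hK] := expansion_circle q0 q_stable (T + nf).+1 proper delta0.
exists K => [|z z1]; first exact: ltnW.
have err := hK z z1; have fr := freq z z1.
have un := resolvent_unit lmi z1.
have qz : (map_poly (real_complex R) q).[z] != 0.
  by apply/negP => /q_stable; rewrite z1 ltxx.
rewrite (realization_response q0 hP un qz) in fr.
rewrite /circle_response.
have -> : \sum_(j < K) (P j)%:C * z^*%C ^+ j =
    1 + k%:C * \sum_(j < K) (expansion p q j)%:C * z^*%C ^+ j.
  case: K TK {hK err} => // K _; rewrite (eq_bigr (fun j : 'I_K.+1 =>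
    (0 == j)%N%:R * z^*%C ^+ j + k%:C * ((expansion p q j)%:C * z^*%C ^+ j))).
    by rewrite big_split -mulr_sumr (sum_ord_delta K.+1 0 (fun j => z^*%C ^+ j)) mul1r.
  by move=> j _; rewrite /P rmorphD rmorphM rmorph_nat /= mulrDl mulrA eq_sym.
set M := \sum_r _ in fr *; move: (\sum_(j < K) _) (_ / _) err fr => S PQ err fr.
have -> : M * (1 + k%:C * S) = M * (1 + k%:C * PQ) + M * (k%:C * (S - PQ)) by ring.
rewrite ReD; have : - (mass mf * (k * delta)) <= complex.Re (M * (k%:C * (S - PQ))).
  apply: Re_ge_norm; rewrite !normrM !rmorphM /=; apply: ler_pM; rewrite ?mulr_ge0 //.
    rewrite rmorph_sum; apply: le_trans (ler_norm_sum _ _ _) _; apply: ler_sum => r _.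
    by rewrite normrM normrM !normrX normcJ z1 !expr1n !mulr1 norm_real_complex.
  by rewrite norm_real_complex gtr0_norm // ler_pM2l // ltcR.
lra.
Qed.

End Stability.

Theorem mainTheorem1 (R : realType) (k : R) (hk : 0 < k)
    (G : {fraction {poly R}}) (hG : in_RHinf G)
    (phi : R -> R) (hphi0 : phi 0 = 0) (hphi : slope_restricted k phi)
    (np : nat) (Ap : 'M[R]_np) (Bp : 'cV[R]_np) (Cp : 'rV[R]_np) (Dp : R)
    (hP : realizes Ap Bp Cp Dp (1 + tf_const k * G))
    (nf nb : nat) (hnf : (1 <= nf)%N) (hnb : (1 <= nb)%N)
    (m : 'cV[R]_(nf + nb).+1)
    (hm0 : forall r : 'I_(nf + nb).+1, lag r = 0 -> m r 0 = 1)
    (X : 'M[R]_(np + maxn nf nb)) (hX : X^T = X)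
    (hLMI : negdef (lmi_matrix Ap Bp Cp Dp m X))
    (hab :
      ((forall r : 'I_(nf + nb).+1, lag r != 0 -> m r 0 <= 0) /\
       0 < \sum_(r < (nf + nb).+1) m r 0)
      \/
      (odd_function phi /\
       exists mp mm : 'cV[R]_(nf + nb).+1,
         m = mp - mm /\
         (forall r : 'I_(nf + nb).+1, lag r = 0 -> mp r 0 = 1 /\ mm r 0 = 0) /\
         (forall r : 'I_(nf + nb).+1, 0 <= mp r 0 /\ 0 <= mm r 0) /\
         \sum_(r < (nf + nb).+1) mp r 0 + \sum_(r < (nf + nb).+1) mm r 0 < 2)) :
  l2_stable G phi.
Proof.
have [p [q [Gpq q0 _ proper q_stable]]] := hG; rewrite Gpq in hP *.
have m_small : \sum_(r | r != Ordinal (center_lt nf nb)) `|m r 0| < 1.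
  by apply: (multiplier_dominant hm0); case: hab => [|[_]]; [left|right].
have m0 := center_coef hm0.
have [gamma g0 hg] := expansion_l1 p q0 q_stable.
have [eps e0 pos] := plant_positive hk hnf hm0 q0 q_stable proper hP hLMI.
have passive : multiplier_passive k nf (fun r => m r 0) phi.
  move=> T v.
  apply: (@zames_falb _ nf _ _ m0 (center_lt nf nb) phi (fun x => k * x - phi x) T v).
  - exact: slope_mono hphi.
  - exact: slope_comono hphi.
  - exact: hphi0.
  - by rewrite hphi0 mulr0 subr0.
  - exact: ltW.
  case: hab => [[mneg _]|[odd _]]; [left=> r rr|right; split=> // a].
    by rewrite mneg // lag_eq0.
  by rewrite odd mulrN opprD opprK.
have [th0 st1] := stable_at1 hk g0 hg e0 m0 m_small pos.
have lti1 j w : conv (scaled (expansion p q) 1) w j = lti (tf_poly p / tf_poly q) w j.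
  by rewrite conv_scaled mul1r lti_expansion.
move=> f g /in_l2P[Qf hf] /in_l2P[Qg hgQ]; split.
  have [v [w [_ lp]]] := @loop_extend _ (scaled (expansion p q) 1) phi f g f g 0
    (step_solvable hk hphi hphi0 th0) ltac:(by []).
  by exists v, w => j; have := lp j; rewrite /loop_at lti1.
move=> v w fb.
have fgb T : sqn T f + sqn T g <= Qf + Qg by apply: lerD.
have [Q wQ] := st1 phi f g v w (Qf + Qg) hphi hphi0 passive fgb
  ltac:(by move=> j; rewrite /loop_at lti1; exact: fb).
split; apply/in_l2P; last by exists Q.
exists (2 * Qf + 2 * (gamma ^+ 2 * Q)) => T.
have -> : sqn T v = sqn T (fun j => f j + conv (expansion p q) w j).
  by apply: eq_sqn => j _; have [-> _] := fb j; rewrite lti_expansion.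
apply: le_trans (sqnD _ _ _) _; apply: lerD; rewrite ler_pM2l //.
by apply: le_trans (conv_bound T w g0 hg) _; rewrite ler_wpM2l ?sqr_ge0.
Qed.
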